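(* Let $(\mathcal{C},\otimes,\mathbf 1)$ be a monoidal category with unit and let $\alpha>0$. (1) Let $I=[0,\alpha]$. The restriction functor $\mathrm{Fun}^{\otimes}(\mathbb{R}_{\ge 0}^{\mathrm{op}},\mathcal{C})\to \mathrm{Fun}^{\otimes}(I^{\mathrm{op}},\mathcal{C})$, $F\mapsto F\circ i_\alpha$, induced by the inclusion $i_\alpha\colon I\hookrightarrow\mathbb{R}_{\ge 0}$, is an equivalence of categories. (2) Let $I=[-\alpha,\alpha]$. The restriction functor $\mathrm{Fun}^{\otimes}(\mathbb{R}^{\mathrm{op}},\mathcal{C})\to \mathrm{Fun}^{\otimes}(I^{\mathrm{op}},\mathcal{C})$, $F\mapsto F\circ j_\alpha$, induced by the inclusion $j_\alpha\colon I\hookrightarrow\mathbb{R}$, is an equivalence of categories.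
   Context: The ordered sets $(\mathbb R,\le)$, $(\mathbb R_{\ge0},\le)$ and any interval $I\subset\mathbb R$ are regarded as categories, with exactly one morphism $a\to b$ if $a\le b$ and none otherwise. A presheaf $K$ on $I$ with values in $\mathcal C$ is a functor $I^{\mathrm{op}}\to\mathcal C$; write $K_a=K(a)$ and $\rho_{a,b}\colon K_b\to K_a$ ($a\le b$) for its restriction morphisms. Let $(\mathcal C,\otimes,\mathbf 1)$ be a monoidal category with associativity isomorphisms $\mathrm{asso}(X,Y,Z)\colon (X\otimes Y)\otimes Z\to X\otimes(Y\otimes Z)$ and unit isomorphisms $\mathrm{lun}_X\colon\mathbf 1\otimes X\to X$, $\mathrm{run}_X\colon X\otimes\mathbf 1\to X$. Let $I$ be one of $[0,\alpha]$, $[-\alpha,\alpha]$, $\mathbb R_{\ge0}$, $\mathbb R$. A monoidal presheaf $(K,\phi_0,\phi_2)$ on $I$ with values in $\mathcal C$ is the data of a presheaf $K$ on $I$ with values in $\mathcal C$, an isomorphism $\phi_0\colon\mathbf 1\to K_0$, and isomorphisms $\phi_2(a,b)\colon K_a\otimes K_b\to K_{a+b}$ for all $a,b$ with $a,b,a+b\in I$, such that: (i) for all $a\le a'$, $b\le b'$ with $a,b,a',b',a+b,a'+b'\in I$: $\rho_{a+b,a'+b'}\circ\phi_2(a',b')=\phi_2(a,b)\circ(\rho_{a,a'}\otimes\rho_{b,b'})$; (ii) for all $a,b,c\in I$ with $a+b,b+c,a+b+c\in I$: $\phi_2(a+b,c)\circ(\phi_2(a,b)\otimes\mathrm{id})=\phi_2(a,b+c)\circ(\mathrm{id}\otimes\phi_2(b,c))\circ\mathrm{asso}(K_a,K_b,K_c)$;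 (iii) for all $a\in I$: $\phi_2(0,a)\circ(\phi_0\otimes\mathrm{id}_{K_a})=\mathrm{lun}_{K_a}$ and $\phi_2(a,0)\circ(\mathrm{id}_{K_a}\otimes\phi_0)=\mathrm{run}_{K_a}$. A morphism of monoidal presheaves $\eta\colon K\to K'$ is a morphism of presheaves such that $\phi'_2(a,b)\circ(\eta_a\otimes\eta_b)=\eta_{a+b}\circ\phi_2(a,b)$ for all $a,b\in I$ with $a+b\in I$. $\mathrm{Fun}^\otimes(I^{\mathrm{op}},\mathcal C)$ denotes the category of monoidal presheaves on $I$ with values in $\mathcal C$ and their morphisms. *)

(* Defs.v *)
From HB Require Import structures.
From mathcomp Require Import all_boot all_order all_algebra.
From mathcomp Require Import boolp reals.

Set Implicit Arguments.
Unset Strict Implicit.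
Unset Printing Implicit Defensive.

Import Order.TTheory GRing.Theory Num.Theory.
Local Open Scope ring_scope.

Declare Scope cat_scope.
Delimit Scope cat_scope with cat.

Reserved Notation "f \oc g" (at level 45, left associativity).
Reserved Notation "X \ox Y" (at level 40, left associativity).
Reserved Notation "f \om g" (at level 40, left associativity).

Record Category := MkCategory {
  ob :> Type;
  hom : ob -> ob -> Type;
  idm : forall X, hom X X;
  comp : forall X Y Z, hom Y Z -> hom X Y -> hom X Z;
  comp_idl : forall X Y (f : hom X Y), comp (idm Y) f = f;
  comp_idr : forall X Y (f : hom X Y), comp f (idm X) = f;
  comp_assoc : forall X Y Z W (h : hom Z W) (g : hom Y Z) (f : hom X Y),
    comp (comp h g) f = comp h (comp g f) }.

Arguments hom {c} X Y.
Arguments idm {c} X.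
Arguments comp {c X Y Z} g f.
Notation "g \oc f" := (comp g f) : cat_scope.
Local Open Scope cat_scope.

Definition is_iso (C : Category) (X Y : C) (f : hom X Y) : Prop :=
  exists g : hom Y X, g \oc f = idm X /\ f \oc g = idm Y.

Definition opcat (C : Category) : Category :=
  @MkCategory C (fun X Y => hom Y X) (fun X => idm X)
    (fun X Y Z g f => f \oc g)
    (fun X Y f => comp_idr f) (fun X Y f => comp_idl f)
    (fun X Y Z W h g f => esym (comp_assoc f g h)).

Record Functor (C D : Category) := MkFunctor {
  fobj :> C -> D;
  fmap : forall X Y, hom X Y -> hom (fobj X) (fobj Y);
  fmap_id : forall X, fmap (idm X) = idm (fobj X);
  fmap_comp : forall X Y Z (g : hom Y Z) (f : hom X Y),
    fmap (g \oc f) = fmap g \oc fmap f }.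

Arguments fmap {C D} f {X Y} _ : rename.

Definition idfun_cat (C : Category) : Functor C C :=
  @MkFunctor C C (fun X => X) (fun X Y f => f)
    (fun X => erefl) (fun X Y Z g f => erefl).

Section CompFunctor.
Variables (C D E : Category) (G : Functor D E) (F : Functor C D).

Fact compF_id (X : C) : fmap G (fmap F (idm X)) = idm (G (F X)).
Proof. by rewrite !fmap_id. Qed.

Fact compF_comp (X Y Z : C) (g : hom Y Z) (f : hom X Y) :
  fmap G (fmap F (g \oc f)) = fmap G (fmap F g) \oc fmap G (fmap F f).
Proof. by rewrite !fmap_comp. Qed.

Definition compF : Functor C E :=
  @MkFunctor C E (fun X => G (F X)) (fun X Y f => fmap G (fmap F f))
    compF_id compF_comp.
End CompFunctor.

Definition opF (C D : Category) (F : Functor C D) :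
    Functor (opcat C) (opcat D) :=
  @MkFunctor (opcat C) (opcat D) (fun X => F X) (fun X Y f => fmap F f)
    (fun X => fmap_id F X) (fun X Y Z g f => fmap_comp F f g).

Record NatTrans (C D : Category) (F G : Functor C D) := MkNatTrans {
  ntc :> forall X : C, hom (F X) (G X);
  ntc_nat : forall (X Y : C) (f : hom X Y),
    ntc Y \oc fmap F f = fmap G f \oc ntc X }.

Lemma NatTrans_eq (C D : Category) (F G : Functor C D) (s t : NatTrans F G) :
  (forall X, s X = t X) -> s = t.
Proof.
case: s t => [s sP] [t tP] /= st.
have {}st : s = t by apply: functional_extensionality_dep.
by rewrite st in sP *; congr MkNatTrans; exact: Prop_irrelevance.
Qed.

Section NatTransOps.
Variables (C D : Category).

Fact nt_id_nat (F : Functor C D) (X Y : C) (f : hom X Y) :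
  idm (F Y) \oc fmap F f = fmap F f \oc idm (F X).
Proof. by rewrite comp_idl comp_idr. Qed.

Definition nt_id (F : Functor C D) : NatTrans F F :=
  MkNatTrans (@nt_id_nat F).

Fact nt_comp_nat (F G H : Functor C D) (t : NatTrans G H) (s : NatTrans F G)
    (X Y : C) (f : hom X Y) :
  (t Y \oc s Y) \oc fmap F f = fmap H f \oc (t X \oc s X).
Proof. by rewrite comp_assoc ntc_nat -comp_assoc ntc_nat comp_assoc. Qed.

Definition nt_comp (F G H : Functor C D) (t : NatTrans G H)
    (s : NatTrans F G) : NatTrans F H := MkNatTrans (nt_comp_nat t s).
End NatTransOps.

Definition nt_whisker (B C D : Category) (F G : Functor C D)
    (s : NatTrans F G) (H : Functor B C) : NatTrans (compF F H) (compF G H) :=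
  @MkNatTrans B D (compF F H) (compF G H) (fun X => s (H X))
    (fun X Y f => ntc_nat s (fmap H f)).

Definition nat_isomorphic (C D : Category) (F G : Functor C D) : Prop :=
  exists s : NatTrans F G, forall X, is_iso (s X).

Definition is_equivalence (C D : Category) (F : Functor C D) : Prop :=
  exists G : Functor D C,
    nat_isomorphic (compF G F) (idfun_cat C) /\
    nat_isomorphic (compF F G) (idfun_cat D).

Record MonoidalCategory := MkMonoidalCategory {
  mcat :> Category;
  tens : mcat -> mcat -> mcat;
  tensm : forall X X' Y Y' : mcat,
    hom X X' -> hom Y Y' -> hom (tens X Y) (tens X' Y');
  tensm_id : forall X Y : mcat, tensm (idm X) (idm Y) = idm (tens X Y);
  tensm_comp : forall (X X' X'' Y Y' Y'' : mcat)
      (f' : hom X' X'') (f : hom X X') (g' : hom Y' Y'') (g : hom Y Y'),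
    tensm (f' \oc f) (g' \oc g) = tensm f' g' \oc tensm f g;
  munit : mcat;
  asso : forall X Y Z : mcat, hom (tens (tens X Y) Z) (tens X (tens Y Z));
  lun : forall X : mcat, hom (tens munit X) X;
  run : forall X : mcat, hom (tens X munit) X;
  asso_iso : forall X Y Z, is_iso (asso X Y Z);
  lun_iso : forall X, is_iso (lun X);
  run_iso : forall X, is_iso (run X);
  asso_nat : forall (X X' Y Y' Z Z' : mcat)
      (f : hom X X') (g : hom Y Y') (h : hom Z Z'),
    asso X' Y' Z' \oc tensm (tensm f g) h
    = tensm f (tensm g h) \oc asso X Y Z;
  lun_nat : forall (X X' : mcat) (f : hom X X'),
    lun X' \oc tensm (idm munit) f = f \oc lun X;
  run_nat : forall (X X' : mcat) (f : hom X X'),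
    run X' \oc tensm f (idm munit) = f \oc run X;
  pentagon : forall W X Y Z : mcat,
    asso W X (tens Y Z) \oc asso (tens W X) Y Z
    = tensm (idm W) (asso X Y Z) \oc asso W (tens X Y) Z
      \oc tensm (asso W X Y) (idm Z);
  triangle : forall X Y : mcat,
    tensm (idm X) (lun Y) \oc asso X munit Y = tensm (run X) (idm Y) }.

Arguments tens {m} X Y : rename.
Arguments tensm {m X X' Y Y'} f g : rename.
Arguments munit {m}.
Arguments asso {m} X Y Z : rename.
Arguments lun {m} X : rename.
Arguments run {m} X : rename.
Notation "X \ox Y" := (tens X Y) : cat_scope.
Notation "f \om g" := (tensm f g) : cat_scope.

Definition pt (R : realType) (I : interval R) : Type := {x : R | x \in I}.

(* The hom-types are booleans coerced to Prop, hence have at most one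
   element. *)
Definition itvcat (R : realType) (I : interval R) : Category :=
  @MkCategory (pt I) (fun a b => val a <= val b) (fun a => lexx (val a))
    (fun a b c (bc : val b <= val c) (ab : val a <= val b) => le_trans ab bc)
    (fun a b f => bool_irrelevance _ _) (fun a b f => bool_irrelevance _ _)
    (fun a b c d h g f => bool_irrelevance _ _).

Definition Presheaf (R : realType) (I : interval R) (C : Category) :=
  Functor (opcat (itvcat I)) C.
Identity Coercion Functor_of_Presheaf : Presheaf >-> Functor.

Definition rho (R : realType) (I : interval R) (C : Category)
    (K : Presheaf I C) (a b : pt I) (ab : val a <= val b) : hom (K b) (K a) :=
  @fmap _ _ K b a ab.

(* To avoid transports between K ((a + b) + c) and K (a + (b + c)), mphi2 takes
   the point c of I together with a proof that a + b = c; such a c exists iff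
   a + b is in I, and both c and the proof are then unique.  In the same way
   mphi0 takes the point 0 of I as a point z with val z = 0.  In mphi2_nat, lc
   is a consequence of la and lb. *)
Record MonPresheaf (R : realType) (I : interval R) (C : MonoidalCategory) :=
  MkMonPresheaf {
  mpsh :> Presheaf I C;
  mphi0 : forall z : pt I, val z = 0 -> hom munit (mpsh z);
  mphi2 : forall a b c : pt I, val a + val b = val c ->
    hom (mpsh a \ox mpsh b) (mpsh c);
  mphi0_iso : forall (z : pt I) (z0 : val z = 0), is_iso (mphi0 z0);
  mphi2_iso : forall (a b c : pt I) (abc : val a + val b = val c),
    is_iso (mphi2 abc);
  mphi2_nat : forall (a a' b b' c c' : pt I)
      (abc : val a + val b = val c) (abc' : val a' + val b' = val c')
      (la : val a <= val a') (lb : val b <= val b') (lc : val c <= val c'),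
    rho mpsh lc \oc mphi2 abc' = mphi2 abc \oc (rho mpsh la \om rho mpsh lb);
  mphi2_asso : forall (a b c ab bc abc : pt I)
      (eab : val a + val b = val ab) (ebc : val b + val c = val bc)
      (eab_c : val ab + val c = val abc) (ea_bc : val a + val bc = val abc),
    mphi2 eab_c \oc (mphi2 eab \om idm (mpsh c))
    = mphi2 ea_bc \oc (idm (mpsh a) \om mphi2 ebc)
      \oc asso (mpsh a) (mpsh b) (mpsh c);
  mphi2_lun : forall (z a : pt I) (z0 : val z = 0)
      (eza : val z + val a = val a),
    mphi2 eza \oc (mphi0 z0 \om idm (mpsh a)) = lun (mpsh a);
  mphi2_run : forall (z a : pt I) (z0 : val z = 0)
      (eaz : val a + val z = val a),
    mphi2 eaz \oc (idm (mpsh a) \om mphi0 z0) = run (mpsh a) }.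

Arguments mphi0 {R I C} _ {z}.
Arguments mphi2 {R I C} _ {a b c}.

(* No compatibility with mphi0 is required of a morphism. *)
Record MonPresheafHom (R : realType) (I : interval R) (C : MonoidalCategory)
    (K K' : MonPresheaf I C) := MkMonPresheafHom {
  mhom :> NatTrans K K';
  mhom_phi2 : forall (a b c : pt I) (abc : val a + val b = val c),
    mphi2 K' abc \oc (mhom a \om mhom b) = mhom c \oc mphi2 K abc }.

Lemma MonPresheafHom_eq (R : realType) (I : interval R) (C : MonoidalCategory)
    (K K' : MonPresheaf I C) (s t : MonPresheafHom K K') :
  (forall a, s a = t a) -> s = t.
Proof.
case: s t => [s sP] [t tP] /= st.
have {}st : s = t by exact: NatTrans_eq.
by rewrite st in sP *; congr MkMonPresheafHom; exact: Prop_irrelevance.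
Qed.

Section FunMon.
Variables (R : realType) (I : interval R) (C : MonoidalCategory).

Fact mhom_id_phi2 (K : MonPresheaf I C) (a b c : pt I)
    (abc : val a + val b = val c) :
  mphi2 K abc \oc (nt_id K a \om nt_id K b) = nt_id K c \oc mphi2 K abc.
Proof. by rewrite /= tensm_id comp_idl comp_idr. Qed.

Definition mhom_id (K : MonPresheaf I C) : MonPresheafHom K K :=
  MkMonPresheafHom (@mhom_id_phi2 K).

Fact mhom_comp_phi2 (K L M : MonPresheaf I C) (t : MonPresheafHom L M)
    (s : MonPresheafHom K L) (a b c : pt I) (abc : val a + val b = val c) :
  mphi2 M abc \oc (nt_comp t s a \om nt_comp t s b)
  = nt_comp t s c \oc mphi2 K abc.
Proof.
by rewrite /= tensm_comp -comp_assoc mhom_phi2 comp_assoc mhom_phi2 comp_assoc.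
Qed.

Definition mhom_comp (K L M : MonPresheaf I C) (t : MonPresheafHom L M)
    (s : MonPresheafHom K L) : MonPresheafHom K M :=
  MkMonPresheafHom (mhom_comp_phi2 t s).

Fact mhom_idl (K L : MonPresheaf I C) (s : MonPresheafHom K L) :
  mhom_comp (mhom_id L) s = s.
Proof. by apply: MonPresheafHom_eq => a /=; exact: comp_idl. Qed.

Fact mhom_idr (K L : MonPresheaf I C) (s : MonPresheafHom K L) :
  mhom_comp s (mhom_id K) = s.
Proof. by apply: MonPresheafHom_eq => a /=; exact: comp_idr. Qed.

Fact mhom_assoc (K L M N : MonPresheaf I C) (u : MonPresheafHom M N)
    (t : MonPresheafHom L M) (s : MonPresheafHom K L) :
  mhom_comp (mhom_comp u t) s = mhom_comp u (mhom_comp t s).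
Proof. by apply: MonPresheafHom_eq => a /=; exact: comp_assoc. Qed.

Definition FunMon : Category :=
  MkCategory mhom_idl mhom_idr mhom_assoc.
End FunMon.

Section Restriction.
Variables (R : realType) (I J : interval R) (IJ : {subset I <= J}).

Definition incl_pt (a : pt I) : pt J := exist _ (val a) (IJ (valP a)).

Definition inclF : Functor (itvcat I) (itvcat J) :=
  @MkFunctor (itvcat I) (itvcat J) incl_pt (fun a b (ab : val a <= val b) => ab)
    (fun a => bool_irrelevance _ _) (fun a b c g f => bool_irrelevance _ _).

Variable C : MonoidalCategory.

Definition restr_obj (K : MonPresheaf J C) : MonPresheaf I C :=
  @MkMonPresheaf R I C (compF K (opF inclF))
    (fun z z0 => @mphi0 _ _ _ K (incl_pt z) z0)
    (fun a b c abc => @mphi2 _ _ _ K (incl_pt a) (incl_pt b) (incl_pt c) abc)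
    (fun z z0 => @mphi0_iso _ _ _ K (incl_pt z) z0)
    (fun a b c abc =>
      @mphi2_iso _ _ _ K (incl_pt a) (incl_pt b) (incl_pt c) abc)
    (fun a a' b b' c c' => @mphi2_nat _ _ _ K (incl_pt a) (incl_pt a')
      (incl_pt b) (incl_pt b') (incl_pt c) (incl_pt c'))
    (fun a b c ab bc abc => @mphi2_asso _ _ _ K (incl_pt a) (incl_pt b)
      (incl_pt c) (incl_pt ab) (incl_pt bc) (incl_pt abc))
    (fun z a => @mphi2_lun _ _ _ K (incl_pt z) (incl_pt a))
    (fun z a => @mphi2_run _ _ _ K (incl_pt z) (incl_pt a)).

Definition restr_hom (K L : MonPresheaf J C) (s : MonPresheafHom K L) :
    MonPresheafHom (restr_obj K) (restr_obj L) :=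
  @MkMonPresheafHom R I C (restr_obj K) (restr_obj L)
    (nt_whisker s (opF inclF))
    (fun a b c abc =>
      @mhom_phi2 _ _ _ _ _ s (incl_pt a) (incl_pt b) (incl_pt c) abc).

Fact restr_id (K : FunMon J C) :
  restr_hom (idm K) = @idm (FunMon I C) (restr_obj K).
Proof. exact: MonPresheafHom_eq. Qed.

Fact restr_comp (K L M : FunMon J C) (t : hom L M) (s : hom K L) :
  restr_hom (t \oc s) = @comp (FunMon I C) _ _ _ (restr_hom t) (restr_hom s).
Proof. exact: MonPresheafHom_eq. Qed.

Definition restriction : Functor (FunMon J C) (FunMon I C) :=
  @MkFunctor (FunMon J C) (FunMon I C) restr_obj restr_hom restr_id restr_comp.
End Restriction.

Lemma sub_i (R : realType) (alpha : R) : {subset `[0, alpha] <= `[0, +oo[}.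
Proof. by move=> x; rewrite !in_itv /= andbT => /andP[]. Qed.

Lemma sub_j (R : realType) (alpha : R) :
  {subset `[- alpha, alpha] <= `]-oo, +oo[}.
Proof. by move=> x; rewrite !in_itv. Qed.

(* Main.v *)
From HB Require Import structures.
From mathcomp Require Import all_boot all_order all_algebra.
From mathcomp Require Import boolp reals.
From mathcomp Require Import ring lra zify.
Require Import Defs.

(** A monoidal presheaf is a categorified homomorphism from a neighbourhood of
    0 in the additive monoid of nonnegative reals, or in the additive group of
    all reals.  The theorem categorifies the fact that a local homomorphism
    defined near 0 extends in one and only one way.  In what follows J is
    [0, +oo[ or ]-oo, +oo[, and B, I are the parts of J where the absolute
    value is at most some radius.

    For sets the fact is elementary ([extend_action]): if maps S a, for a in B,
    satisfy S a (S b x) = S (a + b) x as long as a + b stays in B, then the map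
    iterating S (t / n) n times does not depend on the large integer n (two
    subdivisions have a common refinement) and is additive in t (because the
    maps S a commute).  Let S act on the total space of a family Y of sets
    indexed by an interval D: an element over t is moved to one over t + a.
    The outcome is continuation along D: every fixed element over 0 is the
    value at 0 of a section ([section_exists]).

    The objects to which continuation is applied are modules over a monoidal
    presheaf K on B ([pmodule]): objects F t, for t in D, with associative
    isomorphisms of F t (x) K a with F (t + a) for small a only.  Since the
    action is invertible, a linear map f from F to G is transported from t to
    t + a, so it is determined by its value at 0 and exists as soon as that
    value is compatible with the action of K 0 ([linear_extension]).  This is
    used twice.

    - A morphism between the restrictions to B of monoidal presheaves K and L
      on D is, a fortiori, a linear map given near 0.  Its continuation is
      multiplicative and natural, because both properties propagate along
      subdivisions.  So restriction from D to B is fully faithful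
      ([faithful_small], [full_small]).

    - Let F be a module over J with F 0 isomorphic to the unit.  For fixed t,
      both s |-> F t (x) F s and s |-> F (t + s) are modules, and continuation
      of F t (x) F 0 ~ F t gives a product F t (x) F s ~ F (t + s)
      ([product_exists]).  The pentagon reduces its associativity to the case
      of a small third argument, which is linearity.  Restriction maps of F
      along small distances are those of K, and continuation composes them
      into long ones.  Thus F is a monoidal presheaf on J that extends K
      ([module_monoidal]).

    It remains to find one module with F 0 isomorphic to the unit.  Continuation
    produces maps but not objects, so this step is explicit ([charts]): with a
    step beta and tensor powers P k of K beta, put F t = P k (x) K r where
    t = k beta + r and 0 <= r < beta.  Acting by a may leave the chart k; it
    then lands in a neighbouring chart, and P (k + 1) ~ P k (x) K beta
    identifies the two.  Associativity of the action follows because the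
    identifications between neighbouring charts compose.  As r + a can exceed
    beta, K must be known up to distance 2 beta while it acts up to distance
    beta.  Hence, given K on I of radius alpha, one takes beta = alpha / 2 and
    gets a presheaf on J whose restriction to B, the part of radius beta,
    is isomorphic to that of K.  Full faithfulness from I to B lifts this
    isomorphism to I, which proves essential surjectivity from J to I
    ([cone_equivalence]). *)

Set Implicit Arguments.
Unset Strict Implicit.
Unset Printing Implicit Defensive.
Import Order.TTheory GRing.Theory Num.Theory.
Local Open Scope ring_scope.
Local Open Scope cat_scope.

(** * Isomorphisms and tensor products *)

Section Isos.
Variable C : Category.
Implicit Types X Y Z W : C.

(** Composites are kept associated to the right; this form and the next apply
    an equation between composites in the middle of such a chain. *)
Lemma comp_rw1 X Y Z W (g : hom Y Z) (f : hom X Y) (k : hom X Z) :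
  g \oc f = k -> forall x : hom W X, g \oc (f \oc x) = k \oc x.
Proof. by move=> <- x; rewrite comp_assoc. Qed.

Lemma comp_rw2 X Y Y' Z W (g : hom Y Z) (f : hom X Y) (k : hom Y' Z)
    (h : hom X Y') :
  g \oc f = k \oc h ->
  forall x : hom W X, g \oc (f \oc x) = k \oc (h \oc x).
Proof. by move=> E x; rewrite -!comp_assoc E. Qed.

Lemma iso_mono X Y Z (f : hom Y Z) (g h : hom X Y) :
  is_iso f -> f \oc g = f \oc h -> g = h.
Proof.
by move=> [i [fi _]] /(congr1 (comp i)); rewrite -!comp_assoc fi !comp_idl.
Qed.

Lemma iso_epi X Y Z (f : hom X Y) (g h : hom Y Z) :
  is_iso f -> g \oc f = h \oc f -> g = h.
Proof.
by move=> [i [_ fi]] /(congr1 (comp^~ i)); rewrite !comp_assoc fi !comp_idr.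
Qed.

Lemma iso_idm X : is_iso (idm X).
Proof. by exists (idm X); rewrite comp_idl. Qed.

Lemma iso_comp X Y Z (g : hom Y Z) (f : hom X Y) :
  is_iso g -> is_iso f -> is_iso (g \oc f).
Proof.
move=> [i [ig gi]] [j [jf fj]]; exists (j \oc i); split.
  by rewrite comp_assoc (comp_rw1 ig) comp_idl.
by rewrite comp_assoc (comp_rw1 fj) comp_idl.
Qed.

Lemma iso_cancelr X Y Z (g : hom Y Z) (f : hom X Y) :
  is_iso (g \oc f) -> is_iso f -> is_iso g.
Proof.
move=> gf [j [jf fj]].
suff -> : g = (g \oc f) \oc j.
  by apply: iso_comp => //; exists f.
by rewrite comp_assoc fj comp_idr.
Qed.

Definition inv X Y (f : hom X Y) (f_iso : is_iso f) : hom Y X :=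
  sval (cid f_iso).

Lemma invl X Y (f : hom X Y) (f_iso : is_iso f) : inv f_iso \oc f = idm X.
Proof. by rewrite /inv; case: (cid f_iso) => i []. Qed.

Lemma invr X Y (f : hom X Y) (f_iso : is_iso f) : f \oc inv f_iso = idm Y.
Proof. by rewrite /inv; case: (cid f_iso) => i []. Qed.

Lemma inv_iso X Y (f : hom X Y) (f_iso : is_iso f) : is_iso (inv f_iso).
Proof. by exists f; rewrite invl invr. Qed.

End Isos.

Section Tensor.
Variable C : MonoidalCategory.
Implicit Types X Y Z : C.

Lemma iso_tens X X' Y Y' (f : hom X X') (g : hom Y Y') :
  is_iso f -> is_iso g -> is_iso (f \om g).
Proof.
move=> [i [fl fr]] [j [gl gr]]; exists (i \om j).
by rewrite -!tensm_comp fl fr gl gr !tensm_id.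
Qed.

Lemma tensm_idl X Y Z W (g : hom Y Z) (f : hom X Y) :
  idm W \om (g \oc f) = (idm W \om g) \oc (idm W \om f).
Proof. by rewrite -tensm_comp comp_idl. Qed.

Lemma tensm_idr X Y Z W (g : hom Y Z) (f : hom X Y) :
  (g \oc f) \om idm W = (g \om idm W) \oc (f \om idm W).
Proof. by rewrite -tensm_comp comp_idl. Qed.

Lemma interchange X X' Y Y' (f : hom X X') (g : hom Y Y') :
  (f \om idm Y') \oc (idm X \om g) = (idm X' \om g) \oc (f \om idm Y).
Proof. by rewrite -!tensm_comp !comp_idl !comp_idr. Qed.

Lemma tensm_lr X X' Y Y' (f : hom X X') (g : hom Y Y') :
  f \om g = (f \om idm Y') \oc (idm X \om g).
Proof. by rewrite -tensm_comp comp_idl comp_idr. Qed.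

Lemma tensm_compll X Y Z (U V : C) (g : hom Y Z) (f : hom X Y) (h : hom U V) :
  (g \oc f) \om h = (g \om idm V) \oc (f \om h).
Proof. by rewrite -tensm_comp comp_idl. Qed.

(** Tensoring with an object isomorphic to the unit is faithful; this is what
    cancels a factor K 0. *)
Lemma tensr_inj X Y Z (u : hom munit Z) (f g : hom X Y) :
  is_iso u -> f \om idm Z = g \om idm Z -> f = g.
Proof.
move=> u_iso fg; apply: (iso_epi (run_iso X)); rewrite -!run_nat.
congr (_ \oc _); apply: (iso_mono (iso_tens (iso_idm Y) u_iso)).
by rewrite -!interchange fg.
Qed.

Lemma tensl_inj X Y Z (u : hom munit Z) (f g : hom X Y) :
  is_iso u -> idm Z \om f = idm Z \om g -> f = g.
Proof.
move=> u_iso fg; apply: (iso_epi (lun_iso X)); rewrite -!lun_nat.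
congr (_ \oc _); apply: (iso_mono (iso_tens u_iso (iso_idm Y))).
by rewrite !interchange fg.
Qed.

End Tensor.

(** * Extension of local actions *)

Section LocalAction.
Variables (R : realType) (B : interval R).
Hypothesis B0 : 0 \in B.

Lemma itv_convex (D : interval R) (x y z : R) :
  x \in D -> z \in D -> x <= y <= z -> y \in D.
Proof.
case: D => l u; rewrite !itv_boundlr => /andP[lx _] /andP[_ zu] /andP[xy yz].
apply/andP; split; first by apply: le_trans lx _; rewrite leBSide.
by apply: le_trans zu; rewrite leBSide.
Qed.

Lemma itv_star (D : interval R) (x c : R) :
  0 \in D -> x \in D -> 0 <= c <= 1 -> c * x \in D.
Proof.
move=> D0 Dx /andP[c0 c1]; have [x0|x0] := leP 0 x.
  by apply: (itv_convex D0 Dx); nra.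
by apply: (itv_convex Dx D0); nra.
Qed.

(** The real numbers generated by B: those that lie in B after division by some
    positive integer. *)
Definition reachable (t : R) := exists n : nat, t / n.+1%:R \in B.

Variables (X : Type) (S : R -> X -> X).
Hypothesis SD : forall a b, a \in B -> b \in B -> a + b \in B ->
  forall x, S a (S b x) = S (a + b) x.

(** All partial sums of n steps of length b lie between 0 and n b, hence in B,
    so the hypothesis on S applies at each step. *)
Lemma iter_step (n : nat) (b : R) (x : X) :
  n.+1%:R * b \in B -> iter n.+1 (S b) x = S (n.+1%:R * b) x.
Proof.
elim: n => [|n IHn] nb; first by rewrite mul1r.
have sub k : (k <= n.+2)%N -> k%:R * b \in B.
  move=> kn; have -> : k%:R * b = k%:R / n.+2%:R * (n.+2%:R * b).
    by rewrite mulrA divfK ?pnatr_eq0.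
  by apply: itv_star => //; rewrite divr_ge0//= ler_pdivrMr// mul1r ler_nat.
rewrite iterS IHn; last exact: sub.
have E : n.+2%:R * b = b + n.+1%:R * b by rewrite -addn1 natrD; ring.
rewrite SD ?E//; first by rewrite -[b]mul1r; exact: (sub 1%N).
  exact: sub.
by rewrite -E.
Qed.

(** Both sides equal the iteration over the common refinement of the two
    subdivisions. *)
Lemma iter_indep (m n : nat) (t : R) (x : X) :
  t / m.+1%:R \in B -> t / n.+1%:R \in B ->
  iter m.+1 (S (t / m.+1%:R)) x = iter n.+1 (S (t / n.+1%:R)) x.
Proof.
have refine p q : t / p.+1%:R \in B ->
    iter p.+1 (S (t / p.+1%:R)) x
    = iter (p.+1 * q.+1) (S (t / (p.+1 * q.+1)%:R)) x.
  move=> tp; rewrite iterM; apply: eq_iter => y.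
  have E : q.+1%:R * (t / (p.+1 * q.+1)%:R) = t / p.+1%:R :> R.
    by rewrite natrM; field; rewrite !nat1r !pnatr_eq0.
  by rewrite iter_step E.
by move=> tm tn; rewrite (refine m n)// (refine n m)// mulnC.
Qed.

Lemma refine_in (p q : nat) (t : R) :
  t / p.+1%:R \in B -> t / (p.+1 * q.+1)%:R \in B.
Proof.
move=> tp; have -> : t / (p.+1 * q.+1)%:R = q.+1%:R^-1 * (t / p.+1%:R).
  by rewrite natrM; field; rewrite !nat1r !pnatr_eq0.
by apply: itv_star; rewrite // invr_ge0 ler0n/= invf_le1 ?ler1n ?ltr0n.
Qed.

(** The formula (S (t / n)) ^ n defines the extension.  It is additive because
    for one n that suits s, t and s + t, the maps S (s / n) and S (t / n)
    commute, both composites being S ((s + t) / n). *)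
Lemma extend_action : exists act : R -> X -> X,
  (forall n t x, t / n.+1%:R \in B ->
     act t x = iter n.+1 (S (t / n.+1%:R)) x) /\
  (forall s t x, reachable s -> reachable t -> reachable (s + t) ->
     act (s + t) x = act s (act t x)).
Proof.
have /choice[N NP] : forall t, exists n : nat,
    reachable t -> t / n.+1%:R \in B.
  move=> t; have [[n tn]|nt] := pselect (reachable t); first by exists n.
  by exists 0%N.
exists (fun t x => iter (N t).+1 (S (t / (N t).+1%:R)) x).
have actE n t x : t / n.+1%:R \in B ->
    iter (N t).+1 (S (t / (N t).+1%:R)) x = iter n.+1 (S (t / n.+1%:R)) x.
  by move=> tn; apply: iter_indep => //; apply: NP; exists n.
split=> [n t x tn|s t x sB tB stB]; first exact: actE.
have [n [sn tn stn]] : exists n : nat,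
    [/\ s / n.+1%:R \in B, t / n.+1%:R \in B & (s + t) / n.+1%:R \in B].
  have [p sp] := sB; have [q tq] := tB; have [r str] := stB.
  exists (p.+1 * q.+1 * r.+1).-1; rewrite prednK//; split.
  - by rewrite -mulnA -[(q.+1 * r.+1)%N]prednK//; exact: refine_in.
  - rewrite (mulnC p.+1) -mulnA -[(p.+1 * r.+1)%N]prednK//.
    exact: refine_in.
  - by rewrite mulnC -[(p.+1 * q.+1)%N]prednK//; exact: refine_in.
rewrite !(@actE n)//; rewrite mulrDl in stn *.
move: (s / _) (t / _) sn tn stn => a b Ba Bb Bab {NP actE}.
have comm y : S a (S b y) = S b (S a y) by rewrite !SD// addrC.
elim: n.+1 => [//|k IHk]; rewrite !iterS IHk -SD//; congr (S _ _).
by elim: k (iter k _ x) {IHk} => [//|k IHk] y; rewrite !iterS -comm IHk.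
Qed.

End LocalAction.

(** * Continuation of sections *)

(** A retraction of the line onto D whose increments lie between 0 and those of
    the argument: the steps that it makes are no longer than the given ones and
    have the same sign. *)
Definition clamp_on (R : realType) (D : interval R) (cl : R -> R) : Prop :=
  [/\ forall x, cl x \in D, forall x, x \in D -> cl x = x
    & forall x y, x <= y -> 0 <= cl y - cl x <= y - x].

(** What continuation requires of the pair (B, D).  The clamp makes it possible
    to act on a family over a bounded D by steps that would leave D: such steps
    are shortened. *)
Record small_in (R : realType) (B D : interval R) : Prop := SmallIn {
  small0 : 0 \in B;
  small_sub : {subset B <= D};
  small_reach : forall x, x \in D -> reachable B x;
  small_diff : forall x y, x \in D -> y \in D -> x <= y -> reachable B (y - x);
  small_clamp : exists cl, clamp_on D cl }.

Definition mkpt (R : realType) (I : interval R) (x : R) (xI : x \in I) : pt I :=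
  exist _ x xI.

Lemma pt_eq (R : realType) (I : interval R) (x y : pt I) :
  val x = val y -> x = y.
Proof. exact: val_inj. Qed.

Lemma existT_pt_inj (R : realType) (I : interval R) (Y : pt I -> Type)
    (t : pt I) (y y' : Y t) : existT Y t y = existT Y t y' -> y = y'.
Proof. exact: (@eq_from_Tagged {x : R | x \in I} Y t y y'). Qed.

Section Sections.
Variables (R : realType) (B D : interval R).
Hypothesis BD : small_in B D.
Variables (Y : pt D -> Type)
  (st : forall (t : pt D) (a : pt B) (u : pt D), val t + val a = val u ->
     Y t -> Y u).
Hypothesis stD : forall (t : pt D) (a b ab : pt B) (ta tab : pt D)
  (eab : val a + val b = val ab) (e1 : val t + val a = val ta)
  (e2 : val ta + val b = val tab) (e3 : val t + val ab = val tab) (y : Y t),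
  st e2 (st e1 y) = st e3 y.

(** Steps act on the total space of the pullback of Y to the line along the
    clamp: from s to s + a one moves by cl (s + a) - cl s, which lies in B since
    it is between 0 and a.  These increments add up, so the action is local in
    the sense of [extend_action]; the section is the orbit of y0.  The condition
    on y0 is necessary, as the step of length 0 need not be the identity. *)
Lemma section_exists (z : pt D) (o : pt B) (y0 : Y z)
    (ez : val z + val o = val z) :
  val z = 0 -> st ez y0 = y0 ->
  exists y : forall t, Y t, y z = y0 /\
    forall (t : pt D) (a : pt B) (u : pt D) (e : val t + val a = val u),
      st e (y t) = y u.
Proof.
move=> z0 st0; have [cl0 [clD clK cl_lip]] := small_clamp BD.
pose cl x : pt D := mkpt (clD x).
have clE (t : pt D) : cl (val t) = t by apply: pt_eq; exact: clK (valP t).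
pose X := {s : R & Y (cl s)}.
pose gap (s a : R) := exists b : pt B, val (cl s) + val b = val (cl (s + a)).
have gapP s a : a \in B -> gap s a.
  move=> Ba; have Bd : cl0 (s + a) - cl0 s \in B.
    have [a0|a0] := leP 0 a.
      apply: (itv_convex (small0 BD) Ba).
      by have := @cl_lip s (s + a); rewrite lerDl => /(_ a0); lra.
    apply: (itv_convex Ba (small0 BD)).
    have := @cl_lip (s + a) s; rewrite gerDl => /(_ (ltW a0)); lra.
  by exists (mkpt Bd) => /=; lra.
(* By gapP the first branch applies for a in B; the second makes S total. *)
pose S (a : R) (x : X) : X := match pselect (gap (projT1 x) a) with
  | left h => existT (fun s => Y (cl s)) (projT1 x + a)
       (st (svalP (cid h)) (projT2 x))
  | right _ => x end.
have existT_st (s : R) (b b' : pt B) (u u' : R) (y : Y (cl s))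
    (e : val (cl s) + val b = val (cl u))
    (e' : val (cl s) + val b' = val (cl u')) : u = u' ->
    existT (fun s => Y (cl s)) u (st e y) =
    existT (fun s => Y (cl s)) u' (st e' y).
  move=> uu'; case: u' / uu' e' => e'.
  have bb' : b = b' by apply: pt_eq; move: e'; rewrite -e => /addrI.
  by case: b' / bb' e' => e'; rewrite (Prop_irrelevance e e').
have SE (s a : R) (y : Y (cl s)) b (e : val (cl s) + val b = val (cl (s + a))) :
    S a (existT _ s y) = existT (fun s => Y (cl s)) (s + a) (st e y).
  rewrite /S /=; case: pselect => [h|[]]; last by exists b.
  exact: existT_st.
have SD a b : a \in B -> b \in B -> a + b \in B ->
    forall x, S a (S b x) = S (a + b) x.
  move=> Ba Bb Bab [s y].
  have [c ec] := gapP s _ Bb; have [c' ec'] := gapP (s + b) _ Ba.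
  have [d ed] := gapP s _ Bab; rewrite (SE _ _ _ _ ec) (SE _ _ _ _ ec').
  rewrite (SE _ _ _ _ ed).
  have sab : s + b + a = s + (a + b) by ring.
  have ed' : val (cl s) + val d = val (cl (s + b + a)) by rewrite sab.
  rewrite (stD (ab := d) _ _ _ ed'); first exact: existT_st.
  move: ec ec' ed'; lra.
have [act [actE actD]] := extend_action (small0 BD) SD.
pose p (x : X) : {t : pt D & Y t} := existT _ (cl (projT1 x)) (projT2 x).
have st_p (t : pt D) (y : Y t) (x : X) (a : pt B) (u : pt D)
    (e : val t + val a = val u) : projT1 x = val t -> p x = existT _ t y ->
    projT1 (S (val a) x) = val u /\ p (S (val a) x) = existT _ u (st e y).
  move=> xt; set q := existT _ t y => pq; have qt : projT1 q = t by [].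
  rewrite -[y]/(projT2 q); move: e; rewrite -[t]/(projT1 q) => e.
  rewrite -qt in xt; clearbody q; case: q / pq {qt} xt e => {t y}.
  case: x => s y; rewrite [projT1 _]/= => sE e.
  have e' : val (cl s) + val a = val (cl (s + val a)).
    by rewrite [in RHS]sE e clE.
  rewrite (SE _ _ _ _ e'); split => /=; first by rewrite -e -sE.
  rewrite /p /=; have uE : cl (s + val a) = u by rewrite -(clE u) -e -sE.
  by case: u / uE e => e; rewrite (Prop_irrelevance e e').
have [x0 [x00 px0]] : exists x0 : X, projT1 x0 = 0 /\ p x0 = existT _ z y0.
  move: y0 {ez st0} => y0; have zE : z = cl 0 by rewrite -z0 clE.
  by move: y0; rewrite zE => y0; exists (existT _ 0 y0).
have p_inj x x' : projT1 x = projT1 x' -> p x = p x' -> x = x'.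
  case: x x' => s w [s' w'] /= ss'; case: s' / ss' w' => w'.
  by move=> /(@existT_pt_inj _ _ Y _ w w') ->.
have S_proj a x : a \in B -> projT1 (S a x) = projT1 x + a.
  by case: x => s w /gapP - /(_ s) [b e]; rewrite (SE _ _ _ _ e).
have actB b x : b \in B -> act b x = S b x.
  by move=> Bb; rewrite (actE 0%N) divr1.
have act_o : act 0 x0 = x0.
  have o0 : val o = 0 by move: (ez); rewrite -[RHS]addr0 => /addrI.
  have := st_p z y0 x0 o z ez; rewrite z0 x00 px0 => /(_ erefl erefl)[].
  rewrite st0 o0 actB ?(small0 BD)// => Sx0 pSx0.
  by apply: p_inj; rewrite ?Sx0 ?pSx0.
have act_proj t : t \in D -> projT1 (act t x0) = t.
  move=> Dt; have [n tn] := small_reach BD Dt; rewrite (actE n)//.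
  rewrite -[RHS](@mulfVK _ n.+1%:R) ?pnatr_eq0// mulr_natr.
  move: (t / _) tn => b Bb.
  by elim: n.+1 => [//|k IHk]; rewrite iterS S_proj// IHk mulrSr.
have orbit (t : pt D) : exists y : Y t, p (act (val t) x0) = existT _ t y.
  have := act_proj _ (valP t); rewrite /p.
  case: (act _ _) => s w /= sE; have tE : t = cl s by rewrite sE clE.
  by rewrite tE; exists w.
pose y t := sval (cid (orbit t)).
have yP t : p (act (val t) x0) = existT _ t (y t) := svalP (cid (orbit t)).
exists y; split.
  have := yP z; rewrite z0 act_o px0 => /(@existT_pt_inj _ _ Y) //.
move=> t a u e.
have [_] := st_p t (y t) _ a u e (act_proj _ (valP t)) (yP t).
rewrite -actB ?(valP a)// -actD; last 3 first.
- by exists 0%N; rewrite divr1 (valP a).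
- exact: small_reach (valP t).
- by rewrite addrC e; exact: small_reach (valP u).
by rewrite addrC e yP => /(@existT_pt_inj _ _ Y) ->.
Qed.

End Sections.

(** Induction along a subdivision of the segment from 0 to s: all points met are
    multiples c s with 0 <= c <= 1, so they stay in any interval that contains
    both ends. *)
Lemma reachable_ind (R : realType) (B : interval R) (s : R) (P : R -> Prop) :
  reachable B s ->
  (forall c, 0 <= c <= 1 -> c * s \in B -> P (c * s)) ->
  (forall c d, 0 <= c -> 0 <= d -> c + d <= 1 -> d * s \in B ->
     P (c * s) -> P ((c + d) * s)) ->
  P s.
Proof.
move=> [n sn] P_small P_add; pose d : R := n.+1%:R^-1.
have d0 : 0 <= d by rewrite invr_ge0.
have dn : n.+1%:R * d = 1 by rewrite mulfV// pnatr_eq0.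
have dB : d * s \in B by rewrite mulrC.
have kd k : (k <= n)%N -> 0 <= k.+1%:R * d <= 1.
  by move=> kn; rewrite mulr_ge0//= -[X in _ <= X]dn ler_wpM2r// ler_nat.
suff Pk k : (k <= n)%N -> P (k.+1%:R * d * s).
  by have := Pk n (leqnn n); rewrite dn mul1r.
elim: k => [_|k IHk kn].
  by have := kd 0%N (leq0n n); rewrite mul1r => d1; exact: P_small.
have := kd _ kn; rewrite -[k.+2]addn1 natrD mulrDl mul1r => /andP[_ ?].
by apply: P_add => //; [apply: mulr_ge0|apply: IHk; exact: ltnW].
Qed.

(** * Modules over a monoidal presheaf, and linear maps *)

Section Modules.
Variables (R : realType) (B D : interval R) (C : MonoidalCategory).

(** The relation t + a = u is a parameter, as for the product of a monoidal
    presheaf, so that no transport along equations of points occurs.  No unit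
    axiom is imposed: it follows from associativity, see [unit_step]. *)
Record pmodule (K : MonPresheaf B C) := PModule {
  pmod_ob :> pt D -> C;
  pact : forall (t : pt D) (a : pt B) (u : pt D), val t + val a = val u ->
    hom (pmod_ob t \ox K a) (pmod_ob u);
  pact_iso : forall (t : pt D) (a : pt B) (u : pt D)
    (e : val t + val a = val u), is_iso (pact e);
  pact_asso : forall (t : pt D) (a b ab : pt B) (ta tab : pt D)
      (eab : val a + val b = val ab) (e1 : val t + val a = val ta)
      (e2 : val ta + val b = val tab) (e3 : val t + val ab = val tab),
    pact e2 \oc (pact e1 \om idm (K b))
    = pact e3 \oc (idm (pmod_ob t) \om mphi2 K eab)
      \oc asso (pmod_ob t) (K a) (K b) }.

Hypothesis BD : small_in B D.

(** Linearity forces f u = (f t (x) eta a), conjugated by the actions, for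
    u = t + a.  Associativity of the actions and multiplicativity of eta make
    these steps additive in a, so [section_exists] applies to the family
    t |-> Hom (F t, G t). *)
Lemma linear_extension (K L : MonPresheaf B C) (eta : MonPresheafHom K L)
    (F : pmodule K) (G : pmodule L) (z : pt D) (o : pt B)
    (ez : val z + val o = val z) (f0 : hom (F z) (G z)) :
  val z = 0 ->
  pact G ez \oc (f0 \om eta o) = f0 \oc pact F ez ->
  exists f : forall t, hom (F t) (G t), f z = f0 /\
    forall (t : pt D) (a : pt B) (u : pt D) (e : val t + val a = val u),
      f u \oc pact F e = pact G e \oc (f t \om eta a).
Proof.
move=> z0 f00.
pose st (t : pt D) (a : pt B) (u : pt D) (e : val t + val a = val u)
    (f : hom (F t) (G t)) : hom (F u) (G u) :=
  pact G e \oc (f \om eta a) \oc inv (pact_iso F e).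
have stE t a u e f : @st t a u e f \oc pact F e = pact G e \oc (f \om eta a).
  by rewrite /st comp_assoc invl comp_idr.
have [||f [fz f_st]] := @section_exists _ _ _ BD _ st _ _ o f0 ez z0.
- move=> t a b ab ta tab eab e1 e2 e3 f.
  apply: (iso_epi (iso_comp (pact_iso F e2)
    (iso_tens (pact_iso F e1) (iso_idm (K b))))).
  rewrite -comp_assoc stE comp_assoc -tensm_comp stE comp_idr.
  rewrite -[X in _ \om X]comp_idl tensm_comp -comp_assoc.
  rewrite (pact_asso _ eab _ _ e3).
  rewrite [in RHS](pact_asso _ eab _ _ e3) !comp_assoc asso_nat.
  rewrite (comp_rw1 (invl _)) comp_idl; congr (_ \oc _).
  rewrite -!comp_assoc; congr (_ \oc _).
  by rewrite -!tensm_comp mhom_phi2 comp_idl comp_idr.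
- apply: (iso_epi (pact_iso F ez)); rewrite stE //.
by exists f; split=> // t a u e; rewrite -stE f_st.
Qed.

End Modules.

(** * Restriction to a small interval is fully faithful *)

Lemma rho_id (R : realType) (C : Category) (I : interval R)
    (K : Presheaf I C) (t : pt I) (l : val t <= val t) : rho K l = idm (K t).
Proof.
by rewrite -(fmap_id K t) /rho; congr fmap; exact: bool_irrelevance.
Qed.

Lemma rho_comp (R : realType) (C : Category) (I : interval R)
    (K : Presheaf I C) (t u v : pt I)
    (tu : val t <= val u) (uv : val u <= val v) (tv : val t <= val v) :
  rho K tu \oc rho K uv = rho K tv.
Proof.
by rewrite /rho -fmap_comp; congr fmap; exact: bool_irrelevance.
Qed.

Section FullyFaithful.
Variables (R : realType) (B D : interval R) (BD : small_in B D).
Variable C : MonoidalCategory.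

Let sub := small_sub BD.

Definition selfmod (K : MonPresheaf D C) : pmodule D (restr_obj sub K) :=
  @PModule _ _ _ _ (restr_obj sub K) (fun t => K t)
    (fun t a u => @mphi2 _ _ _ K t (incl_pt sub a) u)
    (fun t a u => @mphi2_iso _ _ _ K t (incl_pt sub a) u)
    (fun t a b ab ta tab eab e1 => @mphi2_asso _ _ _ K t (incl_pt sub a)
       (incl_pt sub b) ta (incl_pt sub ab) tab e1 eab).

Lemma scale_in (s c : R) : s \in D -> 0 <= c <= 1 -> c * s \in D.
Proof. by apply: itv_star; apply: sub; exact: small0 BD. Qed.

Lemma segment_in (t s c : R) :
  t \in D -> t + s \in D -> 0 <= c <= 1 -> t + c * s \in D.
Proof.
move=> tD tsD /andP[c0 c1]; have [s0|s0] := leP 0 s.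
  by apply: (itv_convex tD tsD); nra.
by apply: (itv_convex tsD tD); nra.
Qed.

(** The product isomorphisms determine a morphism at c + d from its values at
    c and d. *)
Lemma faithful_small (K L : MonPresheaf D C) (f g : MonPresheafHom K L) :
  (forall a : pt B, f (incl_pt sub a) = g (incl_pt sub a)) -> f = g.
Proof.
move=> fg; apply: MonPresheafHom_eq => t.
suff : forall u : pt D, val u = val t -> f u = g u by apply.
have H := small_reach BD (valP t).
pose P x := forall u : pt D, val u = x -> f u = g u.
apply: (reachable_ind (P := P) H); rewrite {}/P.
  move=> c c01 cB u uE.
  have uB : val u \in B by rewrite uE.
  suff -> : u = incl_pt sub (mkpt uB) by exact: fg.
  exact: pt_eq.
move=> c d c0 d0 cd1 dB Pc u uE.
have cD : c * val t \in D by apply: scale_in (valP t) _; lra.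
have e : val (mkpt cD) + val (incl_pt sub (mkpt dB)) = val u.
  by rewrite uE /= mulrDl.
apply: (iso_epi (mphi2_iso K e)); rewrite -!mhom_phi2.
by rewrite fg (Pc (mkpt cD)).
Qed.

(** Continuation starts at eta 0 and reproduces eta on B, since there
    K a ~ K 0 (x) K a.  Multiplicativity f (t + s) ~ f t (x) f s is linearity
    for s in B; associativity of the products propagates it along a subdivision
    of s.  A restriction map over a small distance b is an identity tensored
    with the map from K b to K 0, so naturality of eta near 0 suffices. *)
Lemma full_small (K L : MonPresheaf D C)
    (eta : MonPresheafHom (restr_obj sub K) (restr_obj sub L)) :
  exists f : MonPresheafHom K L, forall a : pt B, f (incl_pt sub a) = eta a.
Proof.
pose o : pt B := mkpt (small0 BD); pose z := incl_pt sub o.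
have ez : val z + val o = val z by rewrite /= addr0.
have [//||f [fz f_lin]] := @linear_extension _ _ _ _ BD _ _ eta
  (selfmod K) (selfmod L) z o ez (eta o).
  exact: (mhom_phi2 eta (c := o)).
have f_small a : f (incl_pt sub a) = eta a.
  have e : val z + val a = val (incl_pt sub a) by rewrite /= add0r.
  apply: (iso_epi (pact_iso (selfmod K) e)); rewrite f_lin fz.
  exact: (mhom_phi2 eta (a := o) (b := a) (c := a)).
have f_mult (t s u : pt D) (e : val t + val s = val u) :
    mphi2 L e \oc (f t \om f s) = f u \oc mphi2 K e.
  pose P x := forall s' u' (e' : val t + val s' = val u'), val s' = x ->
    mphi2 L e' \oc (f t \om f s') = f u' \oc mphi2 K e'.
  have H := small_reach BD (valP s).
  suff : P (val s) by apply.
  have tsD : val t + val s \in D by rewrite e (valP u).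
  apply: (reachable_ind (P := P) H); rewrite {}/P => {u e}.
    move=> c c01 cB s' u e s'E; have s'B : val s' \in B by rewrite s'E.
    have s'E' : s' = incl_pt sub (mkpt s'B) by exact: pt_eq.
    move: e; rewrite s'E' f_small => e.
    by rewrite (f_lin t (mkpt s'B) u e).
  move=> c d c0 d0 cd1 dB Pc s' u e s'E.
  have cD : c * val s \in D by apply: scale_in (valP s) _; lra.
  have tcD : val t + c * val s \in D.
    by apply: segment_in => //; [exact: valP|lra].
  pose x := mkpt cD; pose tx := mkpt tcD; pose b : pt B := mkpt dB.
  have e1 : val t + val x = val tx by [].
  have e2 : val tx + val (incl_pt sub b) = val u.
    by rewrite -e s'E /= mulrDl addrA.
  have e3 : val x + val (incl_pt sub b) = val s' by rewrite s'E /= mulrDl.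
  apply: (iso_epi (iso_tens (iso_idm (K t)) (mphi2_iso K e3))).
  apply: (iso_epi (asso_iso _ _ _)).
  have fs' := f_lin x b s' e3; rewrite /= in fs'.
  have fu := f_lin tx b u e2; rewrite /= in fu.
  have ftx : mphi2 L e1 \oc (f t \om f x) = f tx \oc mphi2 K e1 by exact: Pc.
  transitivity (f u \oc (mphi2 K e \oc (idm (K t) \om mphi2 K e3)
    \oc asso (K t) (K x) (K (incl_pt sub b)))); last by rewrite !comp_assoc.
  rewrite -(mphi2_asso K e1 e3 e2 e) -comp_assoc fu [in RHS]comp_assoc.
  rewrite -[in RHS]tensm_comp -ftx comp_idr.
  rewrite tensm_compll -[in RHS]comp_assoc.
  rewrite (mphi2_asso L e1 e3 e2 e) !comp_assoc.
  rewrite asso_nat; congr (_ \oc _); rewrite -!comp_assoc; congr (_ \oc _).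
  by rewrite -!tensm_comp fs' comp_idl comp_idr.
have f_nat0 (b : pt B) (ob : val z <= val (incl_pt sub b)) :
    f z \oc rho K ob = rho L ob \oc f (incl_pt sub b).
  by rewrite fz f_small; exact: (@ntc_nat _ _ _ _ eta b o ob).
have f_nat_step (t u : pt D) (tu : val t <= val u) : val u - val t \in B ->
    f t \oc rho K tu = rho L tu \oc f u.
  move=> utB; pose b : pt B := mkpt utB.
  have e : val t + val (incl_pt sub b) = val u by rewrite /= addrC subrK.
  have e0 : val t + val z = val t by rewrite /= addr0.
  have ob : val z <= val (incl_pt sub b) by rewrite /= subr_ge0.
  apply: (iso_epi (mphi2_iso K e)); rewrite !comp_assoc.
  rewrite (mphi2_nat K e0 e (lexx _) ob) -(f_mult _ _ _ e) -comp_assoc.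
  rewrite -(f_mult _ _ _ e0) -[RHS]comp_assoc (mphi2_nat L e0 e (lexx _) ob).
  by rewrite !comp_assoc -!tensm_comp f_nat0 !rho_id comp_idl comp_idr.
have f_nat (t u : pt D) (tu : val t <= val u) :
    f t \oc rho K tu = rho L tu \oc f u.
  have tuD := @segment_in (val t) (val u - val t) _ (valP t).
  rewrite addrC subrK in tuD; have {}tuD := tuD _ (valP u).
  pose P x := forall (v : pt D) (tv : val t <= val v), val v = val t + x ->
    f t \oc rho K tv = rho L tv \oc f v.
  have H := small_diff BD (valP t) (valP u) tu.
  suff : P (val u - val t) by apply; rewrite addrC subrK.
  apply: (reachable_ind (P := P) H); rewrite {}/P.
    by move=> c c01 cB v tv vE; apply: f_nat_step; rewrite vE addrC addKr.
  move=> c d c0 d0 cd1 dB Pc v tv vE.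
  have cD : val t + c * (val u - val t) \in D by apply: tuD; lra.
  have tc : val t <= val (mkpt cD) by rewrite /= lerDl mulr_ge0// subr_ge0.
  have cv : val (mkpt cD) <= val v.
    by rewrite vE /= lerD2l ler_wpM2r ?subr_ge0//; lra.
  rewrite -(rho_comp K tc cv tv) -(rho_comp L tc cv tv) -comp_assoc Pc//.
  rewrite !comp_assoc f_nat_step//.
  suff -> : val v - val (mkpt cD) = d * (val u - val t) by [].
  by rewrite vE /=; ring.
by exists (MkMonPresheafHom (mhom := @MkNatTrans _ _ K L f
  (fun u t tu => f_nat t u tu)) f_mult).
Qed.

End FullyFaithful.

(** * The product on a module *)

Section ModuleMaps.
Variables (R : realType) (B D : interval R) (C : MonoidalCategory).
Variable (K : MonPresheaf B C).

(** Associativity of an action for three zero arguments shows that, after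
    tensoring with K 0, the action of K 0 is the product of K 0 with itself, the
    same for all modules; so any map commutes with it. *)
Lemma unit_step (F G : pmodule D K) (t u : pt D) (o : pt B)
    (et : val t + val o = val t) (eu : val u + val o = val u)
    (f : hom (F t) (G u)) :
  val o = 0 -> pact G eu \oc (f \om idm (K o)) = f \oc pact F et.
Proof.
move=> o0; have eo : val o + val o = val o by rewrite o0 addr0.
have actK (M : pmodule D K) s (es : val s + val o = val s) :
    pact M es \om idm (K o)
    = (idm (M s) \om mphi2 K eo) \oc asso (M s) (K o) (K o).
  apply: (iso_mono (pact_iso M es)).
  by rewrite (pact_asso M eo es es es) comp_assoc.
apply: (tensr_inj (mphi0_iso K o0)).
rewrite !tensm_idr !actK comp_assoc asso_nat -!comp_assoc.
by rewrite -!tensm_comp tensm_id !comp_idl !comp_idr.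
Qed.

Lemma tensmod_asso (X : C) (F : pmodule D K) (t : pt D) (a b ab : pt B)
    (ta tab : pt D)
    (eab : val a + val b = val ab) (e1 : val t + val a = val ta)
    (e2 : val ta + val b = val tab) (e3 : val t + val ab = val tab) :
  ((idm X \om pact F e2) \oc asso X (F ta) (K b))
    \oc (((idm X \om pact F e1) \oc asso X (F t) (K a)) \om idm (K b))
  = ((idm X \om pact F e3) \oc asso X (F t) (K ab))
    \oc (idm (X \ox F t) \om mphi2 K eab) \oc asso (X \ox F t) (K a) (K b).
Proof.
rewrite tensm_idr comp_assoc (comp_rw2 (asso_nat _ _ _)).
rewrite -tensm_id !comp_assoc (comp_rw2 (asso_nat _ _ _)) pentagon.
rewrite -!comp_assoc -!tensm_idl (pact_asso F eab e1 e2 e3).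
by rewrite !tensm_idl !comp_assoc.
Qed.

Definition tensmod (X : C) (F : pmodule D K) : pmodule D K :=
  @PModule _ _ _ _ K (fun t => X \ox F t)
    (fun t a u e => (idm X \om pact F e) \oc asso X (F t) (K a))
    (fun t a u e => iso_comp (iso_tens (iso_idm X) (pact_iso F e))
       (asso_iso _ _ _))
    (tensmod_asso X F).

Hypothesis addD : forall x y, x \in D -> y \in D -> x + y \in D.

Definition addp (t s : pt D) : pt D := mkpt (addD (valP t) (valP s)).

Fact addp_act (t s : pt D) (a : pt B) (s' : pt D) (e : val s + val a = val s') :
  val (addp t s) + val a = val (addp t s').
Proof. by rewrite /= -e addrA. Qed.

Definition shiftmod (F : pmodule D K) (t : pt D) : pmodule D K :=
  @PModule _ _ _ _ K (fun s => F (addp t s))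
    (fun s a s' e => pact F (addp_act t e))
    (fun s a s' e => pact_iso F (addp_act t e))
    (fun s a b ab sa sab eab e1 e2 e3 =>
       pact_asso F eab (addp_act t e1) (addp_act t e2) (addp_act t e3)).

Definition pcast (F : pmodule D K) (u v : pt D) (e : val u = val v) :
    hom (F u) (F v) :=
  ecast w (hom (F u) (F w)) (pt_eq e) (idm (F u)).

Lemma pcast_id (F : pmodule D K) (u : pt D) (e : val u = val u) :
  pcast F e = idm (F u).
Proof. by rewrite /pcast (Prop_irrelevance (pt_eq e) erefl). Qed.

Lemma pcastK (F : pmodule D K) (u v : pt D) (e : val u = val v)
    (e' : val v = val u) : pcast F e' \oc pcast F e = idm (F u).
Proof.
by have vE := pt_eq e; case: v / vE e e' => e e'; rewrite !pcast_id comp_idl.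
Qed.

Lemma pcast_act (F : pmodule D K) (t t' u u' : pt D) (a : pt B)
    (tt' : val t = val t') (uu' : val u = val u')
    (e : val t + val a = val u) (e' : val t' + val a = val u') :
  pcast F uu' \oc pact F e = pact F e' \oc (pcast F tt' \om idm (K a)).
Proof.
have tE := pt_eq tt'; have uE := pt_eq uu'.
case: t' / tE tt' e' => tt; case: u' / uE uu' => uu e'.
by rewrite !pcast_id tensm_id comp_idl comp_idr (Prop_irrelevance e e').
Qed.

Lemma pcast_iso (F : pmodule D K) (u v : pt D) (e : val u = val v) :
  is_iso (pcast F e).
Proof.
have vE := pt_eq e; case: v / vE e => e; rewrite pcast_id; exact: iso_idm.
Qed.

Hypothesis BD : small_in B D.
Variables (F : pmodule D K) (z : pt D) (z0 : val z = 0).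
Variables (psi : hom munit (F z)) (psi_iso : is_iso psi).

(** For fixed t, continuation in s of the isomorphism F t (x) F 0 ~ F t given
    by psi.  The base value is admissible by [unit_step]. *)
Lemma product_exists :
  exists Phi : forall t s u : pt D, val t + val s = val u ->
    hom (F t \ox F s) (F u),
  (forall (t : pt D) (e : val t + val z = val t),
     Phi t z t e = run (F t) \oc (idm (F t) \om inv psi_iso)) /\
  (forall (t s s' u u' : pt D) (a : pt B) (e : val t + val s = val u)
     (e1 : val s + val a = val s') (e2 : val u + val a = val u')
     (e3 : val t + val s' = val u'),
     Phi t s' u' e3 \oc (idm (F t) \om pact F e1)
       \oc asso (F t) (F s) (K a)
     = pact F e2 \oc (Phi t s u e \om idm (K a))).
Proof.
pose o : pt B := mkpt (small0 BD).
have ez : val z + val o = val z by rewrite /= addr0.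
have e0 t : val t = val (addp t z) by rewrite /= z0 addr0.
pose f0 t := pcast F (e0 t) \oc (run (F t) \oc (idm (F t) \om inv psi_iso)).
have fP t := @linear_extension _ _ _ _ BD _ _ (mhom_id K)
  (tensmod (F t) F) (shiftmod F t) z o ez (f0 t) z0
  (unit_step _ _ _ (erefl : val o = 0)).
pose f t := sval (cid (fP t)).
have fz t : f t z = f0 t := (svalP (cid (fP t))).1.
have f_act t s a s' (e : val s + val a = val s') :
    f t s' \oc ((idm (F t) \om pact F e) \oc asso (F t) (F s) (K a))
    = pact F (addp_act t e) \oc (f t s \om idm (K a)).
  exact: (svalP (cid (fP t))).2.
exists (fun t s u e => pcast F (e : val (addp t s) = val u) \oc f t s).
split=> [t e|t s s' u u' a e e1 e2 e3].
  rewrite fz /f0.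
  suff E : pcast F (e : val (addp t z) = val t) \oc pcast F (e0 t)
    = idm (F t) by rewrite (comp_rw1 E) comp_idl.
  exact: pcastK.
rewrite !comp_assoc f_act tensm_idr -!comp_assoc; congr (_ \oc _).
exact: pcast_act.
Qed.

End ModuleMaps.

Lemma point_ind (R : realType) (B J : interval R) (P : pt J -> Prop) :
  small_in B J ->
  (forall (a : pt B) (u : pt J), val a = val u -> P u) ->
  (forall (s u : pt J) (a : pt B), val s + val a = val u -> P s -> P u) ->
  forall s, P s.
Proof.
move=> BJ Psmall Pstep s; pose Q x := forall u : pt J, val u = x -> P u.
suff : Q (val s) by apply.
apply: (reachable_ind (P := Q) (small_reach BJ (valP s))); rewrite {}/Q.
  by move=> c c01 cB u uE; apply: (Psmall (mkpt cB)).
move=> c d c0 d0 cd1 dB Pc u uE.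
have cJ : c * val s \in J.
  by apply: itv_star (valP s) _; [exact/(small_sub BJ)/(small0 BJ)|lra].
by apply: (Pstep (mkpt cJ) u (mkpt dB)); rewrite ?uE /= ?mulrDl//; exact: Pc.
Qed.

Section Product.
Variables (R : realType) (B J : interval R) (C : MonoidalCategory).
Variables (K : MonPresheaf B C) (BJ : small_in B J).
Hypothesis addJ : forall x y, x \in J -> y \in J -> x + y \in J.
Variables (F : pmodule J K) (z : pt J) (z0 : val z = 0).
Variables (psi : hom munit (F z)) (psi_iso : is_iso psi).
Variable Phi : forall t s u : pt J, val t + val s = val u ->
  hom (F t \ox F s) (F u).
Hypothesis Phi_run : forall (t : pt J) (e : val t + val z = val t),
  Phi e = run (F t) \oc (idm (F t) \om inv psi_iso).
Hypothesis Phi_act : forall (t s s' u u' : pt J) (a : pt B)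
  (e : val t + val s = val u) (e1 : val s + val a = val s')
  (e2 : val u + val a = val u') (e3 : val t + val s' = val u'),
  Phi e3 \oc (idm (F t) \om pact F e1) \oc asso (F t) (F s) (K a)
  = pact F e2 \oc (Phi e \om idm (K a)).

Let sub := small_sub BJ.
Local Notation "x +p y" := (addp addJ x y) (at level 50).

Lemma Phi_iso (t s u : pt J) (e : val t + val s = val u) : is_iso (Phi e).
Proof.
pose P x := forall (v : pt J) (e' : val t + val x = val v), is_iso (Phi e').
have Pstep (x s' : pt J) (a : pt B) : val x + val a = val s' -> P x -> P s'.
  move=> e1 Px u' e3.
  have e2 : val (t +p x) + val a = val u' by rewrite /= -addrA e1.
  apply: (@iso_cancelr _ _ _ _ _ (idm (F t) \om pact F e1
    \oc asso (F t) (F x) (K a))); last first.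
    by apply: iso_comp (asso_iso _ _ _); apply: iso_tens; [exact: iso_idm|
       exact: pact_iso].
  rewrite -comp_assoc (Phi_act (erefl : val t + val x = val (t +p x)) e1 e2 e3).
  apply: iso_comp (pact_iso _ _) _; apply: iso_tens _ (iso_idm _).
  exact: Px.
have Pz : P z.
  move=> v ev; have vE : t = v by apply: pt_eq; rewrite -ev z0 addr0.
  case: v / vE ev => ev; rewrite Phi_run; apply: iso_comp (run_iso _) _.
  by apply: iso_tens (iso_idm _) _; exact: inv_iso.
suff Pall x : P x by exact: Pall.
apply: (point_ind (P := P) BJ) x => //.
by move=> a v av; apply: (Pstep z v a) => //; rewrite z0 add0r.
Qed.

(** The comparison of K with F on B: act by K a on the unit at 0.  It is locked
    so that rewriting with associativity does not look inside. *)
Definition cemb (a : pt B) (u : pt J) (e : val a = val u) : hom (K a) (F u) :=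
  locked (pact F (etrans (etrans (congr1 (fun x => x + val a) z0) (add0r _)) e)
    \oc ((psi \om idm (K a)) \oc inv (lun_iso (K a)))).

Lemma cembE (a : pt B) (u : pt J) (e : val a = val u)
    (ez : val z + val a = val u) :
  cemb e \oc lun (K a) = pact F ez \oc (psi \om idm (K a)).
Proof.
rewrite /cemb -lock !comp_assoc invl comp_idr.
by congr (pact F _ \oc _); exact: Prop_irrelevance.
Qed.

Lemma cemb_iso (a : pt B) (u : pt J) (e : val a = val u) : is_iso (cemb e).
Proof.
rewrite /cemb -lock.
apply: iso_comp (pact_iso _ _) _; apply: iso_comp _ (inv_iso _).
exact: iso_tens (iso_idm _).
Qed.

(** Through the comparison, the product is the action.  Linearity of the product
    reduces this to its value at s = 0, which is the right unit isomorphism, and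
    the triangle axiom. *)
Lemma Phi_cemb (t u v : pt J) (a : pt B) (e : val a = val u)
    (e1 : val t + val u = val v) (e2 : val t + val a = val v) :
  Phi e1 \oc (idm (F t) \om cemb e) = pact F e2.
Proof.
have ez : val t + val z = val t by rewrite z0 addr0.
have eza : val z + val a = val u by rewrite z0 add0r.
apply: (iso_epi (iso_tens (iso_idm (F t)) (lun_iso (K a)))).
rewrite comp_assoc -tensm_idl (cembE _ eza) tensm_idl.
apply: (iso_epi (asso_iso _ _ _)).
rewrite !comp_assoc -asso_nat -[LHS]comp_assoc -[LHS]comp_assoc.
rewrite (Phi_act ez eza e2 e1) Phi_run triangle comp_assoc -tensm_comp.
by rewrite comp_idl comp_assoc -tensm_comp invl comp_idl tensm_id comp_idr.
Qed.

Definition assoc_at (x : pt J) := forall (t s ts sx tsx : pt J)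
  (ets : val t + val s = val ts) (esx : val s + val x = val sx)
  (ets_x : val ts + val x = val tsx) (et_sx : val t + val sx = val tsx),
  Phi ets_x \oc (Phi ets \om idm (F x))
  = Phi et_sx \oc (idm (F t) \om Phi esx) \oc asso (F t) (F s) (F x).

(** For a small third argument, associativity is linearity of the product. *)
Lemma assoc_small (a : pt B) (u : pt J) : val a = val u -> assoc_at u.
Proof.
move=> e t s ts su tsu ets esu etsu et_su.
have esa : val s + val a = val su by rewrite e.
have etsa : val ts + val a = val tsu by rewrite e.
apply: (iso_epi (iso_tens (iso_idm (F t \ox F s)) (cemb_iso e))).
rewrite comp_assoc interchange -[LHS]comp_assoc (Phi_cemb _ _ etsa).
rewrite -(Phi_act _ esa etsa et_su) !comp_assoc -tensm_id asso_nat.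
by rewrite (comp_rw1 (esym (tensm_idl _ _ _))) Phi_cemb.
Qed.

(** The pentagon, as in the proof that associativity for two factors gives it
    for their product. *)
Lemma assoc_add (x y xy : pt J) (exy : val x + val y = val xy) :
  assoc_at x -> assoc_at y -> assoc_at xy.
Proof.
move=> Px Py t s ts sxy tsxy ets es_xy ets_xy et_sxy.
pose sx := s +p x; pose tsx := t +p sx.
have esx : val s + val x = val sx by [].
have etsx : val t + val sx = val tsx by [].
have ets_x : val ts + val x = val tsx by rewrite -ets /= addrA.
have esx_y : val sx + val y = val sxy by rewrite -es_xy -exy /= addrA.
have etsx_y : val tsx + val y = val tsxy.
  by rewrite -ets_xy -exy -ets /= !addrA.
apply: (iso_epi (iso_tens (iso_idm (F t \ox F s)) (Phi_iso exy))).
apply: (iso_epi (asso_iso _ _ _)).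
transitivity (Phi etsx_y \oc
    ((Phi ets_x \oc (Phi ets \om idm (F x))) \om idm (F y))).
  rewrite [LHS]comp_assoc [LHS]comp_assoc (comp_rw2 (interchange _ _)).
  rewrite -(tensm_id (F x)) -asso_nat -[LHS]comp_assoc -[LHS]comp_assoc.
  by rewrite -(Py _ _ _ _ _ ets_x exy etsx_y ets_xy) comp_assoc -tensm_idr.
rewrite (Px _ _ _ _ _ ets esx ets_x etsx) !tensm_idr; set r := RHS.
rewrite !comp_assoc (comp_rw2 (Py _ _ _ _ _ etsx esx_y etsx_y et_sxy)).
rewrite (comp_rw2 (asso_nat _ _ _)) !comp_assoc.
rewrite (comp_rw1 (esym (tensm_idl _ _ _))).
rewrite (Py _ _ _ _ _ esx exy esx_y es_xy) !tensm_idl !comp_assoc.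
rewrite /r -(tensm_id (F t)) !comp_assoc (comp_rw2 (asso_nat _ _ _)) pentagon.
by rewrite !comp_assoc.
Qed.

Lemma Phi_asso (x : pt J) : assoc_at x.
Proof.
apply: (point_ind BJ) x; first exact: assoc_small.
move=> s u a e Ps; have aJ : val a \in J by apply: sub; exact: valP.
apply: (@assoc_add s (mkpt aJ)) => //; exact: (@assoc_small a).
Qed.

(** A unit on the right is a unit on the left: by associativity and the triangle
    axiom the two sides agree after tensoring with F 0 and multiplying. *)
Lemma Phi_lun (t : pt J) (e : val z + val t = val t) :
  Phi e \oc (psi \om idm (F t)) = lun (F t).
Proof.
have ezz : val z + val z = val z by rewrite z0 addr0.
apply: (tensl_inj psi_iso); apply: (iso_mono (Phi_iso e)).
apply: (iso_epi (asso_iso _ _ _)); rewrite tensm_idl !comp_assoc -asso_nat.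
rewrite -[LHS]comp_assoc -[LHS]comp_assoc -(Phi_asso ezz e e e) Phi_run.
rewrite triangle comp_assoc -tensm_comp comp_idl [X in X \om _]comp_assoc.
by rewrite -tensm_comp invl comp_idl tensm_id comp_idr.
Qed.

(** Checked after multiplication by F 0 on the left, where [Phi_cemb] turns both
    sides into actions; this avoids the compatibility of the left unit with the
    associator. *)
Lemma cemb_mult (a b ab : pt B) (u v w : pt J) (eab : val a + val b = val ab)
    (ea : val a = val u) (eb : val b = val v) (ew : val ab = val w)
    (e : val u + val v = val w) :
  Phi e \oc (cemb ea \om cemb eb) = cemb ew \oc mphi2 K eab.
Proof.
have ez (t : pt J) : val z + val t = val t by rewrite z0 add0r.
have ezu : val z + val a = val u by rewrite z0 add0r.
have euv : val u + val b = val w by rewrite eb.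
have ezw : val z + val ab = val w by rewrite z0 add0r.
apply: (tensl_inj psi_iso); apply: (iso_mono (Phi_iso (ez w))).
rewrite (tensm_idl _ (Phi e)) (tensm_idl _ (cemb ew)).
rewrite (comp_rw1 (Phi_cemb _ _ ezw)).
apply: (iso_epi (asso_iso _ _ _)).
rewrite -(pact_asso F eab ezu euv ezw) !comp_assoc -asso_nat.
rewrite -!comp_assoc -(Phi_asso (ez u) e e (ez w)) comp_assoc -tensm_comp.
rewrite comp_idl (Phi_cemb _ _ ezu) tensm_lr interchange -[LHS]comp_assoc.
by rewrite Phi_cemb.
Qed.

(** * Restriction maps on a module *)

(* Commuting a restriction over a distance d past the action of K b uses K at
   b + d: the margin eps around B' keeps b + d in B. *)
Variables (eps : R) (B' : interval R).
Hypothesis eps_small : small_in `[0, eps] `[0, +oo[.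
Hypothesis B'J : small_in B' J.
Hypothesis B'B : forall b d, b \in B' -> 0 <= d <= eps -> b + d \in B.
Hypothesis nonnegJ : forall x, 0 <= x -> x \in J.

Let o : pt B := mkpt (small0 BJ).

Fact addo (u : pt J) : val u + val o = val u. Proof. exact: addr0. Qed.

(** The restriction map from u' = u + d to u: F u' ~ F u (x) K d, restrict K d
    to K 0, and F u (x) K 0 ~ F u. *)
Definition small_rho (u u' : pt J) (d : pt B) (od : val o <= val d)
    (e : val u + val d = val u') : hom (F u') (F u) :=
  locked (pact F (addo u) \oc (idm (F u) \om rho K od) \oc inv (pact_iso F e)).

Lemma small_rhoE (u u' : pt J) (d : pt B) (od : val o <= val d)
    (e : val u + val d = val u') :
  small_rho od e \oc pact F e = pact F (addo u) \oc (idm (F u) \om rho K od).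
Proof. by rewrite /small_rho -lock comp_assoc invl comp_idr. Qed.

(** Restricting u' to u amounts to restricting the last factor K b' to K b, for
    any presentation u' = t + b', u = t + b.  All properties of small
    restrictions come from naturality of the product of K in this way. *)
Lemma small_rho_act (t u u' : pt J) (b b' d : pt B) (od : val o <= val d)
    (bb' : val b <= val b') (e : val u + val d = val u')
    (etb : val t + val b = val u) (etb' : val t + val b' = val u') :
  small_rho od e \oc pact F etb'
  = pact F etb \oc (idm (F t) \om rho K bb').
Proof.
have ebd : val b + val d = val b'.
  by move: etb'; rewrite -e -etb -addrA => /addrI.
have ebo : val b + val o = val b by exact: addr0.
apply: (iso_epi (iso_tens (iso_idm (F t)) (mphi2_iso K ebd))).
apply: (iso_epi (asso_iso _ _ _)); rewrite !comp_assoc.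
rewrite -[X in _ \oc X = _]comp_assoc -(pact_asso F ebd etb e etb').
rewrite (comp_rw1 (small_rhoE _ _)) comp_assoc -interchange -comp_assoc.
rewrite (pact_asso F ebo etb (addo u) etb) !comp_assoc -tensm_id asso_nat.
rewrite !(comp_rw1 (esym (tensm_idl _ _ _))).
by rewrite (mphi2_nat K ebo ebd (lexx _) od) rho_id.
Qed.

Lemma small_rho_comp (u v w : pt J) (a b ab : pt B)
    (oa : val o <= val a) (ob : val o <= val b) (oab : val o <= val ab)
    (e1 : val u + val a = val v) (e2 : val v + val b = val w)
    (e3 : val u + val ab = val w) :
  small_rho oa e1 \oc small_rho ob e2 = small_rho oab e3.
Proof.
have aab : val a <= val ab.
  have -> : val ab = val a + val b; last by rewrite lerDl.
  by apply: (@addrI _ (val u)); rewrite e3 -e2 -e1 addrA.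
apply: (iso_epi (pact_iso F e3)); rewrite small_rhoE comp_assoc.
rewrite (small_rho_act ob aab e2 e1 e3) -comp_assoc small_rhoE comp_assoc.
by rewrite -tensm_idl rho_comp.
Qed.

Lemma small_rho_id (u : pt J) (d : pt B) (od : val o <= val d)
    (e : val u + val d = val u) : small_rho od e = idm (F u).
Proof.
have dE : o = d.
  by apply: pt_eq; apply: (@addrI _ (val u)); rewrite e addo.
apply: (iso_epi (pact_iso F e)); rewrite small_rhoE comp_idl.
case: d / dE od e => od e; rewrite rho_id tensm_id comp_idr.
by rewrite (Prop_irrelevance (addo u) e).
Qed.

Lemma eps_in (a : pt `[0, eps]) : val a \in B.
Proof.
rewrite -[val a]add0r; apply: B'B; first exact: small0 B'J.
by have := valP a; rewrite in_itv.
Qed.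

Lemma eps_ge0 (a : pt `[0, eps]) : val o <= val (mkpt (eps_in a)).
Proof. by have := valP a; rewrite in_itv => /andP[]. Qed.

(** For fixed t, continuation of the identity of F t in the family of maps from
    F (t + x) to F t, for x >= 0; a step composes with a small restriction. *)
Lemma restriction_exists :
  exists res : forall t u : pt J, val t <= val u -> hom (F u) (F t),
    (forall (t : pt J) (tt : val t <= val t), res t t tt = idm (F t)) /\
    (forall (t u v : pt J) (d : pt B) (tu : val t <= val u)
       (tv : val t <= val v) (od : val o <= val d)
       (e : val u + val d = val v), val d <= eps ->
       res t u tu \oc small_rho od e = res t v tv).
Proof.
pose P (t : pt J) (res : forall u : pt J, val t <= val u -> hom (F u) (F t)) :=
  (forall tt : val t <= val t, res t tt = idm (F t)) /\
    (forall (u v : pt J) (d : pt B) (tu : val t <= val u)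
       (tv : val t <= val v) (od : val o <= val d)
       (e : val u + val d = val v), val d <= eps ->
       res u tu \oc small_rho od e = res v tv).
suff H (t : pt J) : exists res, P t res.
  exists (fun t => sval (cid (H t))); split=> [t|t].
    exact: (svalP (cid (H t))).1.
  exact: (svalP (cid (H t))).2.
have D_ge0 (x : pt `[0, +oo[) : 0 <= val x.
  by have := valP x; rewrite in_itv /= andbT.
have Jt (x : pt `[0, +oo[) : val t + val x \in J.
  by apply: addJ (valP t) _; exact: nonnegJ.
(* Maps from F u for every u over t + x, to avoid casts between such u. *)
pose Y (x : pt `[0, +oo[) := forall u : pt J, val t + val x = val u ->
  hom (F u) (F t).
have est (x x' : pt `[0, +oo[) (a : pt `[0, eps]) (u : pt J) :
    val x + val a = val x' -> val t + val x' = val u ->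
    val (mkpt (Jt x)) + val (mkpt (eps_in a)) = val u.
  by move=> e <- /=; rewrite -addrA; congr (_ + _).
pose st (x : pt `[0, +oo[) (a : pt `[0, eps]) (x' : pt `[0, +oo[)
    (e : val x + val a = val x') (y : Y x) : Y x' :=
  fun u eu =>
    y (mkpt (Jt x)) erefl \oc small_rho (eps_ge0 a) (est _ _ _ _ e eu).
pose z' : pt `[0, +oo[ := mkpt (small_sub eps_small (small0 eps_small)).
pose o' : pt `[0, eps] := mkpt (small0 eps_small).
have ez' : val z' + val o' = val z' by exact: addr0.
pose y0 : Y z' := fun u e => pcast F (etrans (esym e) (addr0 _)).
have [|//||y [yz y_st]] := @section_exists _ _ _ eps_small Y st _ z' o' y0 ez'.
- move=> x a b ab xa xab eab e1 e2 e3 y.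
  apply: functional_extensionality_dep => u.
  apply: functional_extensionality_dep => eu.
  rewrite /st comp_assoc.
  by rewrite (small_rho_comp _ _ (eps_ge0 ab) _ _ (est _ _ _ _ e3 eu)).
- apply: functional_extensionality_dep => u.
  apply: functional_extensionality_dep => eu.
  have vu : mkpt (Jt z') = u by apply: pt_eq; rewrite -eu.
  rewrite /st; case: u / vu eu => eu; rewrite small_rho_id comp_idr.
  by rewrite (Prop_irrelevance eu erefl).
have gapD (u : pt J) (tu : val t <= val u) : val u - val t \in `[0, +oo[.
  by rewrite in_itv /= andbT subr_ge0.
have gapE (u : pt J) (tu : val t <= val u) :
    val t + val (mkpt (gapD u tu)) = val u.
  by rewrite /= addrC subrK.
exists (fun u tu => y (mkpt (gapD u tu)) u (gapE u tu)).
split=> [tt|u v d tu tv od e d_eps].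
  move: (mkpt _) (gapE t tt) => x ex; have xz : z' = x.
    by apply: pt_eq; apply: (@addrI _ (val t)); rewrite ex; exact: addr0.
  by case: x / xz ex => ex; rewrite yz /y0 pcast_id.
move: (mkpt _) (gapE u tu) (mkpt _) (gapE v tv) => x ex x' ex'.
have dI : val d \in `[0, eps] by rewrite in_itv /= od.
have exx : val x + val (mkpt dI) = val x'.
  by apply: (@addrI _ (val t)); rewrite addrA ex ex'.
rewrite -(y_st _ _ _ exx) /st.
have uE : mkpt (Jt x) = u by apply: pt_eq; rewrite -ex.
case: u / uE ex tu e => ex tu e; rewrite (Prop_irrelevance ex erefl).
congr (_ \oc _); move: (eps_ge0 _) (est _ _ _ _ _ _).
have dE : d = mkpt (eps_in (mkpt dI)) by exact: pt_eq.
rewrite -dE => od' e'; congr small_rho; exact: Prop_irrelevance.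
Qed.

Variable res : forall t u : pt J, val t <= val u -> hom (F u) (F t).
Arguments res {t u}.
Hypothesis res_id : forall (t : pt J) (tt : val t <= val t),
  res tt = idm (F t).
Hypothesis res_small : forall (t u v : pt J) (d : pt B) (tu : val t <= val u)
  (tv : val t <= val v) (od : val o <= val d) (e : val u + val d = val v),
  val d <= eps -> res tu \oc small_rho od e = res tv.

Lemma chain_ind (t : pt J) (P : pt J -> Prop) :
  P t ->
  (forall (u v : pt J) (d : pt B), val t <= val u -> val o <= val d ->
     val d <= eps -> val u + val d = val v -> P u -> P v) ->
  forall u, val t <= val u -> P u.
Proof.
move=> Pt Pstep u tu; pose Q x := forall v : pt J, val v = val t + x -> P v.
suff : Q (val u - val t) by apply; rewrite addrC subrK.
have dD : val u - val t \in `[0, +oo[ by rewrite in_itv /= andbT subr_ge0.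
have step c v (w : pt J) (tv : val t <= val v) :
    c \in `[0, eps] -> val w = val v + c -> P v -> P w.
  move=> cI wE; apply: (Pstep v w (mkpt (eps_in (mkpt cI)))) => //=.
    by move: cI; rewrite in_itv => /andP[].
  by move: cI; rewrite in_itv => /andP[].
apply: (reachable_ind (P := Q) (small_reach eps_small dD)); rewrite {}/Q.
  by move=> c c01 cI v vE; apply: (step _ t v (lexx _) cI vE Pt).
move=> c d c0 d0 cd1 dI Pc v vE.
have tcJ : val t + c * (val u - val t) \in J.
  by apply: addJ (valP t) _; apply: nonnegJ; rewrite mulr_ge0// subr_ge0.
apply: (step _ (mkpt tcJ) v _ dI).
- by rewrite /= lerDl mulr_ge0// subr_ge0.
- by rewrite vE /= mulrDl addrA.
- exact: Pc.
Qed.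

Lemma res_comp (t u v : pt J) (tu : val t <= val u) (uv : val u <= val v)
    (tv : val t <= val v) : res tu \oc res uv = res tv.
Proof.
pose P w := forall (uw : val u <= val w) (tw : val t <= val w),
  res tu \oc res uw = res tw.
suff : P v by apply.
apply: (chain_ind (P := P)) uv => {v tv}.
  move=> uu tu'.
  by rewrite res_id comp_idr (bool_irrelevance tu tu').
move=> v w d uv od deps e Pv uw tw.
rewrite -(res_small uv uw od e deps) -comp_assoc (Pv uv (le_trans tu uv)).
exact: res_small.
Qed.

Lemma res_cemb (a a' : pt B) (u u' : pt J) (ea : val a = val u)
    (ea' : val a' = val u') (aa' : val a <= val a') (uu' : val u <= val u') :
  cemb ea \oc rho K aa' = res uu' \oc cemb ea'.
Proof.
pose P v := forall (b : pt B) (eb : val b = val v) (ab : val a <= val b)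
  (uv : val u <= val v), cemb ea \oc rho K ab = res uv \oc cemb eb.
suff : P u' by apply.
apply: (chain_ind (P := P)) uu'.
  move=> b eb ab uu; have bE : a = b by apply: pt_eq; rewrite ea eb.
  case: b / bE eb ab => ea1 aa; rewrite rho_id res_id comp_idl comp_idr.
  by rewrite (Prop_irrelevance ea ea1).
move=> v w d uv od deps e Pv b eb ab uw.
have vB : val v \in B.
  apply: (itv_convex (valP a) (valP b)); rewrite ea uv eb -e.
  by rewrite lerDl; exact: od.
have av : val a <= val (mkpt vB) by rewrite ea.
have vb : val (mkpt vB) <= val b by rewrite eb -e lerDl; exact: od.
rewrite -(rho_comp K av vb ab) -comp_assoc.
rewrite (Pv (mkpt vB) erefl av uv) -(res_small uv uw od e deps) !comp_assoc.
congr (_ \oc _).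
have evb : val z + val (mkpt vB) = val v by rewrite z0 add0r.
have eb' : val z + val b = val w by rewrite z0 add0r.
apply: (iso_epi (lun_iso (K b))); rewrite !comp_assoc -lun_nat.
rewrite (comp_rw1 (cembE _ evb)) (cembE _ eb') comp_assoc interchange.
by rewrite -!comp_assoc (small_rho_act od vb e evb eb').
Qed.

(** In the second variable, naturality for one small restriction is linearity of
    the product. *)
Lemma res_Phi_r (t s s' u u' : pt J) (ss' : val s <= val s')
    (uu' : val u <= val u') (e : val t + val s = val u)
    (e' : val t + val s' = val u') :
  res uu' \oc Phi e' = Phi e \oc (idm (F t) \om res ss').
Proof.
pose P v := forall (w : pt J) (sv : val s <= val v) (uw : val u <= val w)
  (ew : val t + val v = val w),
  res uw \oc Phi ew = Phi e \oc (idm (F t) \om res sv).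
suff : P s' by apply.
apply: (chain_ind (P := P)) ss'.
  move=> w ss uw ew; have wE : u = w by apply: pt_eq; rewrite -e -ew.
  case: w / wE uw ew => uu ew; rewrite !res_id tensm_id comp_idl comp_idr.
  by rewrite (Prop_irrelevance e ew).
move=> v v' d sv od deps ed Pv w' sv' uw' ew'.
pose w := t +p v; have ew : val t + val v = val w by [].
have ewd : val w + val d = val w' by rewrite -ew' -ed /= addrA.
have uw : val u <= val w by rewrite -e /= lerD2l.
rewrite -(res_small uw uw' od ewd deps) -(res_small sv sv' od ed deps).
rewrite tensm_idl -[RHS]comp_assoc -(Pv w sv uw ew) !comp_assoc.
congr (_ \oc _); apply: (iso_epi (iso_tens (iso_idm (F t)) (pact_iso F ed))).
apply: (iso_epi (asso_iso _ _ _)).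
rewrite !comp_assoc (comp_rw1 (esym (tensm_idl _ _ _))) small_rhoE.
rewrite -[X in _ \oc X = _]comp_assoc (Phi_act ew ed ewd ew').
rewrite (comp_rw1 (small_rhoE _ _)) comp_assoc -interchange -comp_assoc.
rewrite -(Phi_act ew (addo v) (addo w) ew) !comp_assoc -tensm_id asso_nat.
by rewrite tensm_idl comp_assoc.
Qed.

(** In the first variable one must move K d past F b.  For b in B' this is
    possible inside K, as K d (x) K b ~ K (d + b) is natural in d and d + b lies
    in B; the general case follows by associativity, writing b as a sum. *)
Lemma small_rho_Phi (a a' b ab ab' : pt J) (d : pt B) (od : val o <= val d)
    (deps : val d <= eps) (ea : val a + val d = val a')
    (ed : val ab + val d = val ab')
    (e : val a + val b = val ab) (e' : val a' + val b = val ab') :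
  small_rho od ed \oc Phi e' = Phi e \oc (small_rho od ea \om idm (F b)).
Proof.
pose P b := forall (a a' ab ab' : pt J) (ea : val a + val d = val a')
  (ed : val ab + val d = val ab')
  (e : val a + val b = val ab) (e' : val a' + val b = val ab'),
  small_rho od ed \oc Phi e' = Phi e \oc (small_rho od ea \om idm (F b)).
have Psmall (x : pt B') (v : pt J) : val x = val v -> P v.
  move=> xv p p' pv pv' ep epv e1 e1'.
  have d_eps : 0 <= val d <= eps by apply/andP; split; first exact: od.
  have xB : val x \in B by rewrite -[val x]addr0 B'B ?lexx ?(valP x)//; lra.
  have xdB : val d + val x \in B by rewrite addrC B'B ?(valP x).
  pose y : pt B := mkpt xB; pose yd : pt B := mkpt xdB.
  have e2 : val p + val y = val pv by rewrite /= xv.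
  have e2' : val p' + val y = val pv' by rewrite /= xv.
  have edy : val d + val y = val yd by [].
  have eoy : val o + val y = val y by rewrite /= add0r.
  have y_yd : val y <= val yd by rewrite lerDr; exact: od.
  have ep_yd : val p + val yd = val pv' by rewrite -e2' -ep /= addrA.
  apply: (iso_epi (iso_tens (iso_idm (F p')) (cemb_iso (a := y) xv))).
  rewrite [LHS]comp_assoc [RHS]comp_assoc interchange.
  rewrite (Phi_cemb _ _ e2') (comp_rw1 (Phi_cemb _ _ e2)).
  apply: (iso_epi (iso_tens (pact_iso F ep) (iso_idm (K y)))).
  rewrite [LHS]comp_assoc (pact_asso F edy ep e2' ep_yd) [RHS]comp_assoc.
  rewrite -tensm_idr small_rhoE tensm_idr.
  rewrite (comp_rw1 (pact_asso F eoy (addo p) e2 e2)).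
  rewrite -!comp_assoc (small_rho_act od y_yd epv e2 ep_yd) !comp_assoc.
  rewrite asso_nat !(comp_rw1 (esym (tensm_idl _ _ _))).
  by rewrite (mphi2_nat K eoy edy od (lexx _)) rho_id.
suff Pall x : P x by exact: Pall.
apply: (point_ind (P := P) B'J) x => //.
move=> s v x esx Ps p p' pv pv' ep epv e1 e1'.
have xJ : val x \in J by apply: (small_sub B'J); exact: valP.
pose w : pt J := mkpt xJ; have ew : val s + val w = val v by [].
pose ps := p +p s; pose ps' := p' +p s.
have eps1 : val p + val s = val ps by [].
have eps1' : val p' + val s = val ps' by [].
have eps2 : val ps + val w = val pv by rewrite -e1 -ew /= addrA.
have eps2' : val ps' + val w = val pv' by rewrite -e1' -ew /= addrA.
have epsd : val ps + val d = val ps' by rewrite /= -ep addrAC.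
apply: (iso_epi (iso_tens (iso_idm (F p')) (Phi_iso ew))).
apply: (iso_epi (asso_iso _ _ _)).
rewrite [LHS]comp_assoc [LHS]comp_assoc -[X in _ \oc X = _]comp_assoc.
rewrite -(Phi_asso eps1' ew eps2' e1') -[LHS]comp_assoc.
rewrite (Psmall x w erefl _ _ _ _ epsd epv eps2 eps2').
rewrite [LHS]comp_assoc -tensm_idr.
rewrite (Ps _ _ _ _ ep epsd eps1 eps1') tensm_idr -[LHS]comp_assoc.
rewrite (Phi_asso eps1 ew eps2 e1) !comp_assoc asso_nat tensm_id.
by rewrite (comp_rw2 (interchange _ _)).
Qed.

Lemma res_Phi_l (a a' b u u' : pt J) (aa' : val a <= val a')
    (uu' : val u <= val u') (e : val a + val b = val u)
    (e' : val a' + val b = val u') :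
  res uu' \oc Phi e' = Phi e \oc (res aa' \om idm (F b)).
Proof.
pose P v := forall (w : pt J) (av : val a <= val v) (uw : val u <= val w)
  (ew : val v + val b = val w),
  res uw \oc Phi ew = Phi e \oc (res av \om idm (F b)).
suff : P a' by apply.
apply: (chain_ind (P := P)) aa'.
  move=> w aa uw ew; have wE : u = w by apply: pt_eq; rewrite -e -ew.
  case: w / wE uw ew => uu ew; rewrite !res_id tensm_id comp_idl comp_idr.
  by rewrite (Prop_irrelevance e ew).
move=> v v' d av od deps ed Pv w' av' uw' ew'.
pose w := v +p b; have ew : val v + val b = val w by [].
have ewd : val w + val d = val w' by rewrite -ew' -ed /= addrAC.
have uw : val u <= val w by rewrite -e /= lerD2r.
rewrite -(res_small uw uw' od ewd deps) -(res_small av av' od ed deps).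
rewrite tensm_idr -[RHS]comp_assoc -(Pv w av uw ew) !comp_assoc.
by congr (_ \oc _); exact: small_rho_Phi.
Qed.

Definition res_presheaf : Presheaf J C :=
  @MkFunctor (opcat (itvcat J)) C (fun t => F t) (fun u t tu => res tu)
    (fun t => res_id (lexx (val t)))
    (fun v u t tu uv => esym (res_comp tu uv (le_trans tu uv))).

Definition res_phi0 (t : pt J) (t0 : val t = 0) : hom munit (F t) :=
  pcast F (etrans z0 (esym t0)) \oc psi.

Fact res_phi0_iso (t : pt J) (t0 : val t = 0) : is_iso (res_phi0 t0).
Proof. exact: iso_comp (pcast_iso _ _) psi_iso. Qed.

Fact res_phi0E (z0' : val z = 0) : res_phi0 z0' = psi.
Proof. by rewrite /res_phi0 pcast_id comp_idl. Qed.

Fact res_Phi (a a' b b' c c' : pt J) (e : val a + val b = val c)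
    (e' : val a' + val b' = val c') (aa' : val a <= val a')
    (bb' : val b <= val b') (cc' : val c <= val c') :
  res cc' \oc Phi e' = Phi e \oc (res aa' \om res bb').
Proof.
have em : val a + val b' = val (a +p b') by [].
have cm : val c <= val (a +p b') by rewrite -e /= lerD2l.
have mc' : val (a +p b') <= val c' by rewrite -e' /= lerD2r.
rewrite -(res_comp cm mc' cc') comp_assoc (res_Phi_l aa' mc' em e').
rewrite -comp_assoc (res_Phi_r bb' cm e em) comp_assoc -interchange.
by rewrite -tensm_lr.
Qed.

Fact res_lun (t a : pt J) (t0 : val t = 0) (e : val t + val a = val a) :
  Phi e \oc (res_phi0 t0 \om idm (F a)) = lun (F a).
Proof.
have tz : z = t by apply: pt_eq; rewrite t0.
by case: t / tz t0 e => t0 e; rewrite res_phi0E Phi_lun.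
Qed.

Fact res_run (t a : pt J) (t0 : val t = 0) (e : val a + val t = val a) :
  Phi e \oc (idm (F a) \om res_phi0 t0) = run (F a).
Proof.
have tz : z = t by apply: pt_eq; rewrite t0.
case: t / tz t0 e => t0 e; rewrite res_phi0E Phi_run comp_assoc -tensm_idl.
by rewrite invl tensm_id comp_idr.
Qed.

Definition res_monoidal : MonPresheaf J C :=
  @MkMonPresheaf R J C res_presheaf res_phi0 Phi res_phi0_iso Phi_iso res_Phi
    (fun a b c ab bc abc eab ebc eab_c ea_bc =>
       @Phi_asso c a b ab bc abc eab ebc eab_c ea_bc)
    res_lun res_run.

Lemma res_monoidal_restr (I : interval R) (BI : {subset B <= I})
    (IJ : {subset I <= J}) :
  exists s : MonPresheafHom K (restr_obj BI (restr_obj IJ res_monoidal)),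
    forall a, is_iso (s a).
Proof.
pose j (a : pt B) := incl_pt IJ (incl_pt BI a).
pose c (a : pt B) : hom (K a) (F (j a)) := @cemb a (j a) erefl.
have c_nat (a' a : pt B) (aa' : val a <= val a') :
    c a \oc rho K aa' = res (aa' : val (j a) <= val (j a')) \oc c a'.
  exact: res_cemb.
pose L := restr_obj BI (restr_obj IJ res_monoidal).
pose cn := @MkNatTrans _ _ K L c c_nat.
have c_mult (a b ab : pt B) (e : val a + val b = val ab) :
    mphi2 L e \oc (cn a \om cn b) = cn ab \oc mphi2 K e.
  exact: cemb_mult.
by exists (MkMonPresheafHom c_mult) => a; exact: cemb_iso.
Qed.

End Product.

(** The restriction to B is written in two stages, through I, because the points
    of J obtained directly and through I agree only up to a proof. *)
Lemma module_monoidal (R : realType) (B B' I J : interval R) (eps : R)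
    (C : MonoidalCategory) (K : MonPresheaf B C) (BJ : small_in B J)
    (F : pmodule J K) (z : pt J) (psi : hom munit (F z)) :
  (forall x y, x \in J -> y \in J -> x + y \in J) ->
  (forall x, 0 <= x -> x \in J) ->
  small_in B' J -> small_in `[0, eps] `[0, +oo[ ->
  (forall b d, b \in B' -> 0 <= d <= eps -> b + d \in B) ->
  forall (BI : {subset B <= I}) (IJ : {subset I <= J}),
  val z = 0 -> is_iso psi ->
  exists (Kt : MonPresheaf J C)
    (s : MonPresheafHom K (restr_obj BI (restr_obj IJ Kt))),
    forall a, is_iso (s a).
Proof.
move=> addJ nonnegJ B'J epsP B'B BI IJ z0 psi_iso.
have [Phi [Phi_run Phi_act]] := product_exists addJ BJ z0 psi_iso.
have [res [res_id res_small]] := restriction_exists BJ addJ F epsP B'J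
  B'B nonnegJ.
eexists; exact: (res_monoidal_restr addJ z0 Phi_run Phi_act epsP B'J B'B nonnegJ
  res_id res_small BI IJ).
Qed.

(** * Construction of a module by charts *)

Section Charts.
Variables (R : realType) (I B J : interval R) (beta : R) (C : MonoidalCategory).
Hypothesis beta_gt0 : 0 < beta.
Hypothesis addJ : forall x y, x \in J -> y \in J -> x + y \in J.
Hypothesis nonnegJ : forall x, 0 <= x -> x \in J.
Hypothesis IE : forall x, (x \in I) = (x \in J) && (`|x| <= beta + beta).
Hypothesis BE : forall x, (x \in B) = (x \in J) && (`|x| <= beta).
Hypothesis BI : small_in B I.
Variable K : MonPresheaf I C.

Local Notation pos k := (k%:~R * beta).
Hypothesis floorJ : forall t, t \in J -> pos (Num.floor (t / beta)) \in J.

Fact beta_in : beta \in I.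
Proof.
have b0 := ltW beta_gt0.
by rewrite IE nonnegJ// ger0_norm// lerDl.
Qed.

Let step : pt I := mkpt beta_in.

(* The powers of K beta, for k beta in J. *)
Variable P : int -> C.
Hypothesis Pstep : forall k l : int, pos k \in J -> k + 1 = l ->
  exists p : hom (P k \ox K step) (P l), is_iso p.

Definition chart_mod (k : int) := tensmod (P k) (selfmod BI K).

(** The change of charts from l = k + 1 down to k, splitting one K beta off
    P l. *)
Definition shift_chart (k l : int) (kJ : pos k \in J) (kl : k + 1 = l)
    (s x : pt I) (sx : val step + val s = val x) :
    hom (P l \ox K s) (P k \ox K x) :=
  locked ((idm (P k) \om mphi2 K sx) \oc asso (P k) (K step) (K s)
    \oc (inv (svalP (cid (Pstep kJ kl))) \om idm (K s))).

Lemma shift_chartE (k l : int) (kJ : pos k \in J) (kl : k + 1 = l)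
    (s x : pt I) (sx : val step + val s = val x) :
  shift_chart kJ kl sx \oc (sval (cid (Pstep kJ kl)) \om idm (K s))
  = (idm (P k) \om mphi2 K sx) \oc asso (P k) (K step) (K s).
Proof.
by rewrite /shift_chart -lock comp_assoc -tensm_idr invl tensm_id comp_idr.
Qed.

Lemma shift_chart_iso (k l : int) (kJ : pos k \in J) (kl : k + 1 = l)
    (s x : pt I) (sx : val step + val s = val x) :
  is_iso (shift_chart kJ kl sx).
Proof.
rewrite /shift_chart -lock; apply: iso_comp; last first.
  by apply: iso_tens (iso_idm _); exact: inv_iso.
apply: iso_comp (asso_iso _ _ _).
exact: iso_tens (iso_idm _) (mphi2_iso _ _).
Qed.

(** In each chart, P k (x) K x is a module wherever defined; changes of charts
    are linear.  Both sides multiply P k, K beta, K s and K a together. *)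
Lemma shift_chart_act (k l : int) (kJ : pos k \in J) (kl : k + 1 = l)
    (s x s' x' : pt I) (a : pt B)
    (sx : val step + val s = val x) (sx' : val step + val s' = val x')
    (es : val s + val a = val s') (ex : val x + val a = val x') :
  shift_chart kJ kl sx' \oc pact (chart_mod l) es
  = pact (chart_mod k) ex \oc (shift_chart kJ kl sx \om idm _).
Proof.
have p_iso := svalP (cid (Pstep kJ kl)).
apply: (iso_epi (iso_tens (iso_tens p_iso (iso_idm (K s))) (iso_idm _))).
rewrite [RHS]comp_assoc -tensm_idr shift_chartE /=.
rewrite !comp_assoc asso_nat tensm_id -(comp_rw2 (interchange _ _)).
rewrite (comp_rw1 (shift_chartE _ _ _)) tensm_idr (comp_rw2 (asso_nat _ _ _)).
rewrite !comp_assoc (comp_rw1 (esym (tensm_idl _ _ _))).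
have As := @mphi2_asso _ _ _ K step s (incl_pt (small_sub BI) a) x s' x'
  sx es ex sx'.
rewrite As -tensm_id (comp_rw2 (asso_nat _ _ _)).
by rewrite pentagon !tensm_idl !comp_assoc.
Qed.

(** An action of B has length at most beta, the distance of consecutive
    charts, so it leads at most to a neighbouring chart. *)
Definition near_charts (k l : int) :=
  [/\ pos k \in J, pos l \in J & [\/ k = l, l + 1 = k | k + 1 = l]].

(** The identification of the values of neighbouring charts at a common point,
    characterised rather than defined: only one of the three conditions has
    satisfiable premises, and quantifying over these premises avoids a case
    analysis in the types. *)
Definition canonical (k l : int) (x s : pt I)
    (f : hom (P k \ox K x) (P l \ox K s)) : Prop :=
  [/\ forall (kl : k = l) (sx : val s <= val x),
        f = ecast m (hom (P k) (P m)) kl (idm (P k)) \om rho K sx,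
      forall (lJ : pos l \in J) (lk : l + 1 = k)
        (xs : val step + val x = val s), f = shift_chart lJ lk xs
    & forall (kJ : pos k \in J) (kl : k + 1 = l)
        (sx : val step + val s = val x),
        shift_chart kJ kl sx \oc f = idm _].

Lemma canonical_exists (k l : int) (x s : pt I) :
  near_charts k l -> pos k + val x = pos l + val s ->
  exists f : hom (P k \ox K x) (P l \ox K s), canonical f.
Proof.
move=> [kJ lJ [kl|lk|kl]] e.
- have sx : val s <= val x by move: e; rewrite kl => /addrI ->.
  exists (ecast m (hom (P k) (P m)) kl (idm (P k)) \om rho K sx).
  split=> [kl' sx'|lJ' lk'|kJ' kl']; [|lia|lia].
  by rewrite (Prop_irrelevance kl' kl) (bool_irrelevance sx' sx).
- have xs : val step + val x = val s.
    by apply: (@addrI _ (pos l)); rewrite -e -lk /= intrD; ring.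
  exists (shift_chart lJ lk xs); split=> [kl|lJ' lk' xs'|kJ' kl]; [lia| |lia].
  rewrite (bool_irrelevance lJ' lJ) (Prop_irrelevance lk' lk).
  by rewrite (Prop_irrelevance xs' xs).
- have sx : val step + val s = val x.
    by apply: (@addrI _ (pos k)); rewrite e -kl /= intrD; ring.
  exists (inv (shift_chart_iso kJ kl sx)).
  split=> [kl'|lJ' lk|kJ' kl' sx']; [lia|lia|].
  rewrite (bool_irrelevance kJ' kJ) (Prop_irrelevance kl' kl).
  by rewrite (Prop_irrelevance sx' sx) invr.
Qed.

Lemma canonical_same (k : int) (x : pt I)
    (f : hom (P k \ox K x) (P k \ox K x)) :
  canonical f -> f = idm (P k \ox K x).
Proof. by move=> [/(_ erefl (lexx _)) -> _ _]; rewrite rho_id tensm_id. Qed.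

Lemma canonical_iso (k l : int) (x s : pt I)
    (f : hom (P k \ox K x) (P l \ox K s)) :
  near_charts k l -> pos k + val x = pos l + val s -> canonical f -> is_iso f.
Proof.
move=> [kJ lJ [kl|lk|kl]] e.
- case: l / kl lJ e f => _ /addrI/pt_eq xs.
  case: s / xs => f /canonical_same ->.
  exact: iso_idm.
- have xs : val step + val x = val s.
    by apply: (@addrI _ (pos l)); rewrite -e -lk /= intrD; ring.
  by move=> [_ /(_ lJ lk xs) -> _]; exact: shift_chart_iso.
- have sx : val step + val s = val x.
    by apply: (@addrI _ (pos k)); rewrite e -kl /= intrD; ring.
  move=> [_ _ /(_ kJ kl sx) Uf].
  have [V [VU UV]] := shift_chart_iso kJ kl sx.
  have -> : f = V by rewrite -[f]comp_idl -VU comp_assoc Uf comp_idr.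
  by exists (shift_chart kJ kl sx).
Qed.

Lemma canonical_act (k l : int) (x s x' s' : pt I) (a : pt B)
    (ex : val x + val a = val x') (es : val s + val a = val s')
    (f : hom (P k \ox K x) (P l \ox K s))
    (f' : hom (P k \ox K x') (P l \ox K s')) :
  near_charts k l -> pos k + val x = pos l + val s ->
  canonical f -> canonical f' ->
  f' \oc pact (chart_mod k) ex = pact (chart_mod l) es \oc (f \om idm _).
Proof.
move=> [kJ lJ [kl|lk|kl]] e.
- have xs : x = s by apply/pt_eq/(@addrI _ (pos k)); rewrite e kl.
  have xs' : x' = s' by apply: pt_eq; rewrite -ex -es xs.
  case: l / kl {lJ e} f f' => f f'.
  case: s / xs es f => es f; case: s' / xs' es f' => es f'.
  move=> /canonical_same -> /canonical_same ->.
  by rewrite tensm_id comp_idl comp_idr (Prop_irrelevance es ex).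
- have xs : val step + val x = val s.
    by apply: (@addrI _ (pos l)); rewrite -e -lk /= intrD; ring.
  have xs' : val step + val x' = val s' by rewrite -ex -es addrA xs.
  move=> [_ /(_ lJ lk xs) -> _] [_ /(_ lJ lk xs') -> _].
  exact: shift_chart_act.
- have sx : val step + val s = val x.
    by apply: (@addrI _ (pos k)); rewrite e -kl /= intrD; ring.
  have sx' : val step + val s' = val x' by rewrite -ex -es addrA sx.
  move=> [_ _ /(_ kJ kl sx) Uf] [_ _ /(_ kJ kl sx') Uf'].
  apply: (iso_mono (shift_chart_iso kJ kl sx')).
  rewrite -comp_assoc Uf' comp_idl -comp_assoc.
  rewrite (shift_chart_act _ _ sx sx' es ex).
  by rewrite comp_assoc -tensm_idr Uf tensm_id comp_idr.
Qed.

Lemma canonical_uniq (k l : int) (x s : pt I)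
    (f g : hom (P k \ox K x) (P l \ox K s)) :
  near_charts k l -> pos k + val x = pos l + val s ->
  canonical f -> canonical g -> f = g.
Proof.
move=> [kJ lJ [kl|lk|kl]] e.
- have sx : val s <= val x by move: e; rewrite kl => /addrI ->.
  by move=> [/(_ kl sx) -> _ _] [/(_ kl sx) -> _ _].
- have xs : val step + val x = val s.
    by apply: (@addrI _ (pos l)); rewrite -e -lk /= intrD; ring.
  by move=> [_ /(_ lJ lk xs) -> _] [_ /(_ lJ lk xs) -> _].
- have sx : val step + val s = val x.
    by apply: (@addrI _ (pos k)); rewrite e -kl /= intrD; ring.
  move=> [_ _ /(_ kJ kl sx) Uf] [_ _ /(_ kJ kl sx) Ug].
  by apply: (iso_mono (shift_chart_iso kJ kl sx)); rewrite Uf Ug.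
Qed.

(** As k and m are neighbours too, either one of the two changes stays in the
    same chart or the second undoes the first. *)
Lemma canonical_comp (k l m : int) (x s u : pt I)
    (f : hom (P k \ox K x) (P l \ox K s))
    (g : hom (P l \ox K s) (P m \ox K u))
    (h : hom (P k \ox K x) (P m \ox K u)) :
  near_charts k l -> near_charts l m -> near_charts k m ->
  pos k + val x = pos l + val s -> pos l + val s = pos m + val u ->
  canonical f -> canonical g -> canonical h -> g \oc f = h.
Proof.
move=> kl lm km exs esu.
have [Ekl|nkl] := eqVneq k l.
  case: l / Ekl kl lm exs esu f g => _ km' /addrI/pt_eq xs.
  case: s / xs => exu f g /canonical_same -> gP hP; rewrite comp_idr.
  exact: canonical_uniq gP hP.
have [Elm|nlm] := eqVneq l m.
  case: m / Elm lm km esu g h => _ kl' /addrI/pt_eq su.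
  case: u / su => g h fP /canonical_same -> hP; rewrite comp_idl.
  exact: canonical_uniq fP hP.
case: (kl) (lm) (km) => kJ lJ kl_near [_ mJ lm_near] [_ _ km_near].
have Ekm : k = m.
  case: kl_near lm_near km_near => kl_near [] lm_near [] km_near;
    move: nkl nlm; lia.
case: m / Ekm esu g h lm_near {lm km mJ km_near nlm} => esu g h lk_near.
have xu : x = u by apply/pt_eq/(@addrI _ (pos k)); rewrite exs esu.
case: u / xu esu g h => esx g h fP gP /canonical_same ->.
case: kl_near => [kl_eq|lk_eq|kl_eq]; first by rewrite kl_eq eqxx in nkl.
- have xs : val step + val x = val s.
    by apply: (@addrI _ (pos l)); rewrite -exs -lk_eq /= intrD; ring.
  case: fP gP => [_ /(_ lJ lk_eq xs) -> _] [_ _ /(_ lJ lk_eq xs) Ug].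
  apply: (iso_mono (shift_chart_iso lJ lk_eq xs)).
  by rewrite -comp_assoc Ug comp_idl comp_idr.
- have sx : val step + val s = val x.
    by apply: (@addrI _ (pos k)); rewrite exs -kl_eq /= intrD; ring.
  by case: fP gP => [_ _ /(_ kJ kl_eq sx) Uf] [_ /(_ kJ kl_eq sx) -> _].
Qed.

Let kt (t : pt J) : int := Num.floor (val t / beta).

Fact chart_rest (t : pt J) : 0 <= val t - pos (kt t) < beta.
Proof.
have /andP[le1 lt2] := floor_itv (val t / beta).
rewrite -/(kt t) in le1 lt2; rewrite ler_pdivlMr// in le1.
by rewrite ltr_pdivrMr// intrD mulrDl mul1r in lt2; lra.
Qed.

Fact chart_rest_in (t : pt J) : val t - pos (kt t) \in I.
Proof.
have /andP[r0 r1] := chart_rest t.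
by rewrite IE nonnegJ// ger0_norm// andTb; move: beta_gt0; lra.
Qed.

Let rt (t : pt J) : pt I := mkpt (chart_rest_in t).

Fact rest_act_in (t : pt J) (a : pt B) : val (rt t) + val a \in I.
Proof.
have /andP[r0 r1] : 0 <= val (rt t) < beta := chart_rest t.
have := valP a; rewrite BE => /andP[aJ].
rewrite IE (addJ (nonnegJ r0) aJ) andTb !ler_norml => /andP[a1 a2].
by move: beta_gt0; lra.
Qed.

Let rta (t : pt J) (a : pt B) : pt I := mkpt (rest_act_in t a).

Fact chart_near (t u : pt J) (a : pt B) :
  val t + val a = val u -> near_charts (kt t) (kt u).
Proof.
move=> e; split; [exact/floorJ/valP|exact/floorJ/valP|].
have /andP[t0 t1] := chart_rest t; have /andP[u0 u1] := chart_rest u.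
have := valP a; rewrite BE => /andP[_]; rewrite ler_norml => /andP[a1 a2].
have : `|(kt t - kt u)%:~R| * beta < 2 * beta.
  rewrite -[X in _ * X < _]gtr0_norm// -normrM ltr_norml intrB mulrBl; lra.
rewrite ltr_pM2r// -intr_norm (ltr_int _ _ 2) => kk.
have [-> | [|]] : kt t = kt u \/ (kt u + 1 = kt t \/ kt t + 1 = kt u) by lia.
- exact: Or31.
- exact: Or32.
- exact: Or33.
Qed.

Fact chart_pos (t u : pt J) (a : pt B) :
  val t + val a = val u -> pos (kt t) + val (rta t a) = pos (kt u) + val (rt u).
Proof.
move=> e; have -> : val (rta t a) = val t - pos (kt t) + val a by [].
have -> : val (rt u) = val u - pos (kt u) by [].
by move: e; lra.
Qed.

Let transition (t u : pt J) (a : pt B) (e : val t + val a = val u) :=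
  cid (canonical_exists (chart_near e) (chart_pos e)).

(* Act inside the chart of t, where the remainder may exceed beta, then move to
   the chart of u. *)
Let chart_act (t : pt J) (a : pt B) (u : pt J) (e : val t + val a = val u) :
    hom ((P (kt t) \ox K (rt t)) \ox restr_obj (small_sub BI) K a)
      (P (kt u) \ox K (rt u)) :=
  sval (transition e) \oc
    @pact _ _ _ _ _ (chart_mod (kt t)) (rt t) a (rta t a) erefl.

Fact chart_act_iso (t : pt J) (a : pt B) (u : pt J)
  (e : val t + val a = val u) : is_iso (chart_act e).
Proof.
rewrite /chart_act; apply: iso_comp.
  exact: (canonical_iso (chart_near e) (chart_pos e) (svalP (transition e))).
exact: (@pact_iso _ _ _ _ _ (chart_mod (kt t)) (rt t) a (rta t a) erefl).
Qed.

(** Linearity of the change of charts moves it after both actions, where the two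
    changes compose to the canonical one from t to t + a + b.  The latter two
    charts are still neighbours because a + b lies in B. *)
Fact chart_act_asso (t : pt J) (a b ab : pt B) (ta tab : pt J)
    (eab : val a + val b = val ab) (e1 : val t + val a = val ta)
    (e2 : val ta + val b = val tab) (e3 : val t + val ab = val tab) :
  chart_act e2 \oc (chart_act e1 \om idm _)
  = chart_act e3 \oc (idm _ \om mphi2 (restr_obj (small_sub BI) K) eab)
    \oc asso _ _ _.
Proof.
have ex : val (rta t a) + val b = val (rta t ab) by rewrite /= -eab addrA.
have exs : pos (kt t) + val (rta t ab) = pos (kt ta) + val (rta ta b).
  have -> : val (rta t ab) = val t - pos (kt t) + val ab by [].
  have -> : val (rta ta b) = val ta - pos (kt ta) + val b by [].
  by move: eab e1; lra.
have [f' f'P] := canonical_exists (chart_near e1) exs.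
have act_f' := canonical_act ex (erefl : _ = val (rta ta b)) (chart_near e1)
  (chart_pos e1) (svalP (transition e1)) f'P.
have comp_f' := canonical_comp (chart_near e1) (chart_near e2) (chart_near e3)
  exs (chart_pos e2) f'P (svalP (transition e2)) (svalP (transition e3)).
rewrite /chart_act tensm_idr [LHS]comp_assoc (comp_rw2 (esym act_f')).
rewrite (pact_asso (chart_mod (kt t)) eab
  (erefl : val (rt t) + val a = val (rta t a)) ex
  (erefl : val (rt t) + val ab = val (rta t ab))) -comp_f'.
by rewrite !comp_assoc.
Qed.

Definition charts : pmodule J (restr_obj (small_sub BI) K) :=
  PModule chart_act_iso chart_act_asso.

Lemma charts_unit (z : pt J) : val z = 0 ->
  (exists p : hom munit (P 0), is_iso p) ->
  exists psi : hom munit (charts z), is_iso psi.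
Proof.
move=> z0 [p p_iso].
have kz : kt z = 0 by rewrite /kt z0 mul0r floor0.
have rz : val (rt z) = 0 by rewrite /= kz z0 mul0r subr0.
rewrite /= kz; exists ((p \om mphi0 K rz) \oc inv (lun_iso munit)).
apply: iso_comp (inv_iso _); exact: iso_tens (mphi0_iso _ _).
Qed.

End Charts.

(** * From full faithfulness and extension to equivalence *)

Section Equivalence.

Lemma equivalence_intro (C D : Category) (F : Functor C D) :
  (forall (X Y : C) (f g : hom X Y), fmap F f = fmap F g -> f = g) ->
  (forall (X Y : C) (g : hom (F X) (F Y)), exists f : hom X Y, fmap F f = g) ->
  (forall Y : D, exists (X : C) (s : hom Y (F X)), is_iso s) ->
  is_equivalence F.
Proof.
move=> faith full esurj.
pose obj Y := sval (cid (esurj Y)).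
pose s Y : hom Y (F (obj Y)) := sval (cid (svalP (cid (esurj Y)))).
have s_iso Y : is_iso (s Y) := svalP (cid (svalP (cid (esurj Y)))).
pose lift X Y (g : hom (F X) (F Y)) : hom X Y := sval (cid (full X Y g)).
have liftK X Y (g : hom (F X) (F Y)) : fmap F (lift X Y g) = g.
  exact: svalP (cid (full X Y g)).
have lift_iso X Y (g : hom (F X) (F Y)) : is_iso g -> is_iso (lift _ _ g).
  move=> [h [hg gh]]; exists (lift _ _ h).
  by split; apply: faith; rewrite fmap_comp !liftK fmap_id.
pose mor Y Y' (g : hom Y Y') : hom (obj Y) (obj Y') :=
  lift _ _ (s Y' \oc g \oc inv (s_iso Y)).
have mor_id Y : mor Y Y (idm Y) = idm (obj Y).
  by apply: faith; rewrite liftK comp_idr invr fmap_id.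
have mor_comp X Y Z (g : hom Y Z) (f : hom X Y) :
    mor X Z (g \oc f) = mor Y Z g \oc mor X Y f.
  apply: faith; rewrite fmap_comp !liftK !comp_assoc.
  by rewrite (comp_rw1 (invl _)) comp_idl.
pose G := @MkFunctor D C obj mor mor_id mor_comp.
exists G; split.
- pose c X : hom (G (F X)) X := lift _ _ (inv (s_iso (F X))).
  have c_nat X Y (f : hom X Y) : c Y \oc fmap (compF G F) f = f \oc c X.
    apply: faith; rewrite !fmap_comp !liftK !comp_assoc.
    by rewrite (comp_rw1 (invl _)) comp_idl.
  exists (@MkNatTrans C C (compF G F) (idfun_cat C) c c_nat) => X.
  exact/lift_iso/inv_iso.
- pose c Y : hom (F (G Y)) Y := inv (s_iso Y).
  have c_nat X Y (f : hom X Y) : c Y \oc fmap (compF F G) f = f \oc c X.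
    by rewrite /= liftK !comp_assoc (comp_rw1 (invl _)) comp_idl.
  exists (@MkNatTrans D D (compF F G) (idfun_cat D) c c_nat) => Y.
  exact: inv_iso.
Qed.

Variables (R : realType) (C : MonoidalCategory).

Lemma mhom_iso (I : interval R) (K L : FunMon I C) (s : hom K L) :
  (forall a, is_iso (ntc s a)) -> is_iso s.
Proof.
move=> s_iso.
pose t a := inv (s_iso a).
have t_nat (a b : pt I) (ab : val a <= val b) :
    t a \oc rho L ab = rho K ab \oc t b.
  apply: (iso_mono (s_iso a)); apply: (iso_epi (s_iso b)).
  rewrite !comp_assoc invl comp_idr (comp_rw1 (invr _)) comp_idl.
  exact: esym (@ntc_nat _ _ _ _ s b a ab).
have t_mult (a b c : pt I) (abc : val a + val b = val c) :
    mphi2 K abc \oc (t a \om t b) = t c \oc mphi2 L abc.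
  apply: (iso_mono (s_iso c)); apply: (iso_epi (iso_tens (s_iso a) (s_iso b))).
  rewrite !comp_assoc (comp_rw1 (invr _)) comp_idl -tensm_comp !invl tensm_id.
  by rewrite comp_idr mhom_phi2.
exists (MkMonPresheafHom (mhom := @MkNatTrans _ _ L K t
  (fun b a ab => t_nat a b ab)) t_mult).
by split; apply: MonPresheafHom_eq => a /=; rewrite ?invl ?invr.
Qed.

Lemma restriction_faithful (B D : interval R) (BD : small_in B D)
    (K L : FunMon D C) (f g : hom K L) :
  fmap (restriction (small_sub BD) C) f
    = fmap (restriction (small_sub BD) C) g ->
  f = g.
Proof.
move=> fg; apply: (faithful_small (BD := BD)) => a.
exact: (congr1 (fun h => ntc (mhom h) a) fg).
Qed.

Lemma restriction_full (B D : interval R) (BD : small_in B D)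
    (K L : FunMon D C)
    (g : hom (restriction (small_sub BD) C K)
       (restriction (small_sub BD) C L)) :
  exists f : hom K L, fmap (restriction (small_sub BD) C) f = g.
Proof.
have [f fg] := @full_small _ _ _ BD _ _ _ g.
by exists f; apply: MonPresheafHom_eq => a; exact: fg.
Qed.

(** Full faithfulness lifts both the isomorphism and its inverse. *)
Lemma lift_iso_small (B I : interval R) (BI : small_in B I) (K L : FunMon I C)
    (s : MonPresheafHom (restr_obj (small_sub BI) K)
       (restr_obj (small_sub BI) L)) :
  (forall a, is_iso (s a)) -> exists f : hom K L, is_iso f.
Proof.
move=> s_iso.
have [t [ts st]] := @mhom_iso _ (restr_obj (small_sub BI) K)
  (restr_obj (small_sub BI) L) s s_iso.
have [f fs] := restriction_full s; have [g gt] := restriction_full t.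
exists f, g; split; apply: (restriction_faithful (BD := BI)).
  by rewrite fmap_comp fs gt ts fmap_id.
by rewrite fmap_comp fs gt st fmap_id.
Qed.

End Equivalence.

(** * The half-line and the line *)

Definition ball_of (R : realType) (J : interval R) (r : R) (B : interval R) :=
  forall x, (x \in B) = (x \in J) && (`|x| <= r).

Lemma small_ball (R : realType) (J B D : interval R) (r : R) (cl : R -> R) :
  (forall x, 0 <= x -> x \in J) ->
  (forall c x, 0 <= c -> x \in J -> c * x \in J) ->
  0 < r -> ball_of J r B -> {subset B <= D} -> {subset D <= J} ->
  clamp_on D cl -> small_in B D.
Proof.
move=> nonnegJ scaleJ r0 BE BD DJ clP.
have reach x : x \in J -> reachable B x.
  move=> xJ; exists (Num.truncn (`|x| / r)).
  have nr : `|x| / r < (Num.truncn (`|x| / r)).+1%:R.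
    by apply: truncnS_gt.
  set n := Num.truncn _ in nr *.
  rewrite BE mulrC scaleJ ?invr_ge0//= normrM normfV normr_nat.
  rewrite ltr_pdivrMr// in nr; rewrite ler_pdivrMl ?ltr0n// ltW//.
split=> //.
- by rewrite BE nonnegJ//= normr0 ltW.
- by move=> x /DJ; exact: reach.
- by move=> x y _ _ xy; apply/reach/nonnegJ; rewrite subr_ge0.
- by exists cl.
Qed.

Lemma clamp_segment (R : realType) (l u : R) : l <= u ->
  clamp_on `[l, u] (fun x => Num.max l (Num.min x u)).
Proof.
move=> lu; split=> [x|x|x y xy].
- by rewrite in_itv /= le_max lexx /= ge_max lu ge_min lexx orbT.
- by rewrite in_itv /= => /andP[lx xu]; rewrite (min_idPl xu) (max_idPr lx).
- by rewrite !maxElt !minElt; do ![case: ifPn]; rewrite -?leNgt; lra.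
Qed.

Lemma clamp_ray (R : realType) (l : R) : clamp_on `[l, +oo[ (Num.max l).
Proof.
split=> [x|x|x y xy].
- by rewrite in_itv /= le_max lexx.
- by rewrite in_itv /= andbT => /max_idPr.
- by rewrite !maxElt; do ![case: ifPn]; rewrite -?leNgt; lra.
Qed.

Lemma clamp_line (R : realType) : clamp_on `]-oo, +oo[ (@id R).
Proof.
by split=> [x|//|x y xy]; [rewrite in_itv|rewrite subr_ge0 lexx andbT].
Qed.

Lemma ball_ray (R : realType) (r : R) : ball_of `[0, +oo[ r `[0, r].
Proof.
move=> x; rewrite !in_itv /= andbT.
by case: leP => //= x0; rewrite ger0_norm.
Qed.

Lemma ball_line (R : realType) (r : R) : ball_of `]-oo, +oo[ r `[- r, r].
Proof. by move=> x; rewrite !in_itv /= ler_norml. Qed.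

Section Cone.
Variables (R : realType) (J : interval R) (C : MonoidalCategory).
Hypothesis addJ : forall x y, x \in J -> y \in J -> x + y \in J.
Hypothesis nonnegJ : forall x, 0 <= x -> x \in J.
Hypothesis scaleJ : forall c x, 0 <= c -> x \in J -> c * x \in J.
Variables (ball : R -> interval R) (clJ : R -> R) (clI : R -> R -> R).
Hypothesis ballP : forall r, ball_of J r (ball r).
Hypothesis clJP : clamp_on J clJ.
Hypothesis clIP : forall r, 0 < r -> clamp_on (ball r) (clI r).

Fact ball_sub (r : R) : {subset ball r <= J}.
Proof. by move=> x; rewrite ballP => /andP[]. Qed.

Fact ball_small (r : R) : 0 < r -> small_in (ball r) J.
Proof.
move=> r0; apply: (small_ball nonnegJ scaleJ r0 (ballP r) _ _ clJP) => //.
exact: ball_sub.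
Qed.

Fact ball_small_ball (r s : R) : 0 < r -> r <= s -> small_in (ball r) (ball s).
Proof.
move=> r0 rs; have s0 := lt_le_trans r0 rs.
apply: (small_ball nonnegJ scaleJ r0 (ballP r) _ (@ball_sub s) (clIP s0)).
by move=> x; rewrite !ballP => /andP[-> /le_trans]; apply.
Qed.

(** Essential surjectivity uses the radii alpha for K, alpha / 2 for the step of
    the charts and the action, and alpha / 4 for the margin that restriction
    maps need. *)
Lemma cone_equivalence (alpha : R) (IJ : {subset ball alpha <= J}) :
  0 < alpha ->
  (forall t, t \in J ->
     (Num.floor (t / (alpha / 2)))%:~R * (alpha / 2) \in J) ->
  (forall (K : MonPresheaf (ball alpha) C) (step : pt (ball alpha)),
     val step = alpha / 2 ->
     exists P : int -> C, (exists p : hom munit (P 0), is_iso p) /\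
       forall k l : int, k%:~R * (alpha / 2) \in J -> k + 1 = l ->
         exists p : hom (P k \ox K step) (P l), is_iso p) ->
  is_equivalence (restriction IJ C).
Proof.
move=> a0 floorJ powers.
have b0 : 0 < alpha / 2 by rewrite divr_gt0.
have e0 : 0 < alpha / 2 / 2 by rewrite divr_gt0.
have IJ_small := ball_small a0.
have IJE : IJ = small_sub IJ_small by exact: Prop_irrelevance.
have BI : small_in (ball (alpha / 2)) (ball alpha).
  by apply: ball_small_ball => //; lra.
apply: equivalence_intro.
- by move=> K L f g; rewrite IJE; exact: restriction_faithful.
- by move=> K L; rewrite IJE; exact: restriction_full.
move=> K.
have IE x : (x \in ball alpha) = (x \in J) && (`|x| <= alpha / 2 + alpha / 2).
  by rewrite ballP -splitr.
have [P [P0 Pstep]] := powers K (mkpt (beta_in b0 nonnegJ IE)) erefl.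
have zJ : 0 \in J by exact: nonnegJ.
pose F := charts addJ (ballP (alpha / 2)) BI floorJ Pstep.
have [psi psi_iso] : exists psi : hom munit (F (mkpt zJ)), is_iso psi.
  exact: charts_unit.
have [||Kt [s s_iso]] := @module_monoidal _ (ball (alpha / 2))
  (ball (alpha / 2 / 2)) (ball alpha) J (alpha / 2 / 2) C _ (ball_small b0) F _
  psi addJ nonnegJ (ball_small e0) _ _ (small_sub BI) IJ erefl psi_iso.
- apply: (@small_ball _ `[0, +oo[ _ _ _ (Num.max 0) _ _ e0 (ball_ray _)) => //.
  + by move=> x; rewrite in_itv /= andbT.
  + by move=> c x c0; rewrite !in_itv /= !andbT => x0; exact: mulr_ge0.
  + by move=> x; rewrite !in_itv /= andbT => /andP[].
  + exact: clamp_ray.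
- move=> b d; rewrite !ballP !ler_norml => /andP[bJ /andP[b1 b2]] /andP[d0 d1].
  by rewrite (addJ bJ (nonnegJ d0)) andTb; apply/andP; split; lra.
have [f f_iso] := lift_iso_small s_iso.
by exists Kt, f.
Qed.

End Cone.

Fixpoint tens_iter (C : MonoidalCategory) (X : C) (n : nat) : C :=
  if n is m.+1 then tens_iter X m \ox X else munit.

(** The integer powers of X, when Y is an inverse of X. *)
Definition tens_power (C : MonoidalCategory) (Y X : C) (k : int) : C :=
  match k with Posz n => tens_iter X n | Negz n => tens_iter Y n.+1 end.

Lemma tens_power_nonneg (C : MonoidalCategory) (Y X : C) (k l : int) :
  0 <= k -> k + 1 = l ->
  exists p : hom (tens_power Y X k \ox X) (tens_power Y X l), is_iso p.
Proof.
case: k => [n _ <-|//]; have -> : Posz n + 1 = Posz n.+1 by lia.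
by exists (idm _); exact: iso_idm.
Qed.

Lemma tens_power_step (C : MonoidalCategory) (Y X : C) (p : hom (Y \ox X) munit)
    (k l : int) :
  is_iso p -> k + 1 = l ->
  exists q : hom (tens_power Y X k \ox X) (tens_power Y X l), is_iso q.
Proof.
move=> p_iso; have cancel Z : exists q : hom (Z \ox Y \ox X) Z, is_iso q.
  exists (run Z \oc (idm Z \om p) \oc asso Z Y X).
  apply: iso_comp (asso_iso _ _ _); apply: iso_comp (run_iso _) _.
  exact: iso_tens (iso_idm _) p_iso.
case: k => [n|[|n]]; first exact: tens_power_nonneg.
- by move=> <-; exact: cancel.
- have -> : Negz n.+1 + 1 = Negz n by lia.
  by move=> <-; exact: cancel.
Qed.

Theorem theorem1p9 (R : realType) (C : MonoidalCategory) (alpha : R)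
    (alpha_gt0 : 0 < alpha) :
  is_equivalence
    (restriction (I := `[0, alpha]) (J := `[0, +oo[) (sub_i (alpha := alpha)) C)
  /\
  is_equivalence
    (restriction (I := `[- alpha, alpha]) (J := `]-oo, +oo[)
       (sub_j (alpha := alpha)) C).
Proof.
have b0 : 0 < alpha / 2 by rewrite divr_gt0.
split.
- apply: (@cone_equivalence _ `[0, +oo[ C _ _ _ (fun r => `[0, r]) (Num.max 0)
    (fun r x => Num.max 0 (Num.min x r)) _ _ _ alpha) => //.
  + by move=> x y; rewrite !in_itv /= !andbT; exact: addr_ge0.
  + by move=> x; rewrite in_itv /= andbT.
  + by move=> c x c0; rewrite !in_itv /= !andbT => x0; exact: mulr_ge0.
  + exact: ball_ray.
  + exact: clamp_ray.
  + by move=> r r0; apply: clamp_segment; exact: ltW.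
  + move=> t; rewrite !in_itv /= !andbT => t0.
    by rewrite mulr_ge0 ?(ltW b0)// ler0z floor_ge0 divr_ge0// ltW.
  + move=> K step stepE; exists (tens_power munit (K step)).
    split=> [|k l]; first by exists (idm munit); exact: iso_idm.
    rewrite in_itv /= andbT (pmulr_lge0 _ b0) ler0z.
    exact: tens_power_nonneg.
- apply: (@cone_equivalence _ `]-oo, +oo[ C _ _ _ (fun r => `[- r, r]) id
    (fun r x => Num.max (- r) (Num.min x r)) _ _ _ alpha) => //.
  + exact: ball_line.
  + exact: clamp_line.
  + by move=> r r0; apply: clamp_segment; lra.
  + move=> K step stepE.
    have negI : - (alpha / 2) \in `[- alpha, alpha].
      by rewrite in_itv /=; apply/andP; lra.
    have zI : 0 \in `[- alpha, alpha] by rewrite in_itv /=; apply/andP; lra.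
    pose neg : pt `[- alpha, alpha] := mkpt negI.
    exists (tens_power (K neg) (K step)).
    split=> [|k l _]; first by exists (idm munit); exact: iso_idm.
    have e : val neg + val step = val (mkpt zI) by rewrite stepE /= addNr.
    apply: (@tens_power_step _ _ _
      (inv (mphi0_iso K (erefl : val (mkpt zI) = 0)) \oc mphi2 K e)).
    exact: iso_comp (inv_iso _) (mphi2_iso _ _).
Qed.
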